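(* Suppose the self-similar measure $\mu$ satisfies the standard technical assumptions. If the set of essential points of $\mu$ is the open interval $(0,1)$, then the set of local dimensions of $\mu$, $\{\dim\mu(x):x\in[0,1],\ \dim\mu(x)\text{ exists}\}$, consists of a closed interval together with the value $\dim\mu(0)=\dim\mu(1)$.
   Context: Measure. Let $m\ge 1$, $0<\varrho<1$, $d_0<\dots<d_m$ real, $S_j(x)=\varrho x+d_j$, $\mathcal A=\{0,\dots,m\}$. For $\sigma=(j_1,\dots,j_n)\in\mathcal A^n$ put $S_\sigma=S_{j_1}\circ\cdots\circ S_{j_n}$. Given $p_j>0$ with $\sum_j p_j=1$, $\mu$ is the unique Borel probability measure with $\mu=\sum_{j=0}^m p_j\,\mu\circ S_j^{-1}$. It is of finite type if there is a finite set $F\subset[0,\infty)$ such that for all $n\ge1$ and $\sigma,\sigma'\in\mathcal A^n$ either $\varrho^{-n}|S_\sigma(0)-S_{\sigma'}(0)|>c$ or $\varrho^{-n}|S_\sigma(0)-S_{\sigma'}(0)|\in F$, where $c=(1-\varrho)^{-1}(d_m-d_0)$. Standard technical assumptions: $\mu$ is such a measure and is of finite type; $p_0=p_m=\min_j p_j$; and $\operatorname{supp}\mu=[0,1]$ (equivalently $d_0=0$, $d_m=1-\varrho$, $d_{i+1}-d_i\le\varrho$ for all $i$). Local dimension. $\dim\mu(x)=\lim_{r\to0^+}\frac{\log\mu([x-r,x+r])}{\log r}$ when the limit exists. A closed interval may be a single point. Net intervals and characteristic vectors. For $n\ge1$ let $h_1<\dots<h_{s_n}$ be the distinct elements of $\{S_\sigma(0),S_\sigma(1):\sigma\in\mathcal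 A^n\}$; the net intervals of level $n$ are $\mathcal F_n=\{[h_j,h_{j+1}]:1\le j<s_n\}$, and $\mathcal F_0=\{[0,1]\}$. Each $\Delta\in\mathcal F_n$ ($n\ge1$) lies in a unique $\widehat\Delta\in\mathcal F_{n-1}$, its parent ($\Delta$ is a child of $\widehat\Delta$). For $\Delta=[a,b]\in\mathcal F_n$ put $\ell_n(\Delta)=\varrho^{-n}(b-a)$, and let $V_n(\Delta)=(a_1,\dots,a_k)$ be the increasing list of the distinct values $\varrho^{-n}(a-S_\sigma(0))$ over $\sigma\in\mathcal A^n$ with $\Delta\subseteq S_\sigma[0,1]$. Let $r_n(\Delta)$ be the position of $\Delta$, from left to right, among the children of $\widehat\Delta$ with the same $\ell_n$ and $V_n$. The characteristic vector is $\mathcal C_n(\Delta)=(\ell_n(\Delta),V_n(\Delta),r_n(\Delta))$, with $\mathcal C_0([0,1])=(1,(0),1)$. $\Omega$ is the (finite) set of all characteristic vectors. $\beta\in\Omega$ is a child of $\alpha\in\Omega$ (its parent) if $\alpha=\mathcal C_{n-1}(\widehat\Delta)$, $\beta=\mathcal C_n(\Delta)$ for some parent/child pair. An admissible path is a tuple $(\gamma_1,\dots,\gamma_n)$ in $\Omega$ with each $\gamma_j$ the parent of $\gamma_{j+1}$. A symbolic representation of $x\in[0,1]$ is $[x]=(\mathcal C_0(\Delta_0),\mathcal C_1(\Delta_1),\dots)$, where $x\in\Delta_n\in\mathcal F_n$ and $\Delta_n$ is the parent of $\Delta_{n+1}$ for all $n$ (unique unless $x$ is an endpoint of a net interval, in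 which case there may be two). Loop and essential classes. A non-empty $\Omega'\subseteq\Omega$ is a loop class if for all $\alpha,\beta\in\Omega'$ there is an admissible path $(\gamma_1,\dots,\gamma_n)$, $n\ge2$, with all $\gamma_j\in\Omega'$, $\gamma_1=\alpha$, $\gamma_n=\beta$. The essential class $\Omega_0$ is the loop class with the further property that every child in $\Omega$ of an element of $\Omega_0$ is in $\Omega_0$; there is exactly one such class (a known result of Feng). A point $x$ is essential if it has a symbolic representation $(\gamma_0,\gamma_1,\dots)$ with $\gamma_j\in\Omega_0$ for all large $j$. *)

(* Defs.v *)
From HB Require Import structures.
From mathcomp Require Import all_boot all_order all_algebra.
From mathcomp Require Import all_classical all_reals all_analysis.

Set Implicit Arguments.
Unset Strict Implicit.
Unset Printing Implicit Defensive.

Import Order.TTheory GRing.Theory Num.Theory.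
Import numFieldNormedType.Exports.

Local Open Scope classical_set_scope.
Local Open Scope ring_scope.

Section IFS.
Context (R : realType) (m : nat) (rho : R) (d : 'I_m.+1 -> R).

Definition Smap (j : 'I_m.+1) (x : R) : R := rho * x + d j.

(* Leftmost letter outermost: Sword (j_1, ..., j_n) = S_{j_1} o ... o S_{j_n} *)
Definition Sword (s : seq 'I_m.+1) (x : R) : R := foldr Smap x s.

Definition self_similar (p : 'I_m.+1 -> R)
    (mu : probability (measurableTypeR R) R) : Prop :=
  forall A : set (measurableTypeR R), measurable A ->
    mu A = (\sum_(j < m.+1) (p j)%:E * mu (Smap j @^-1` A))%E.

Definition finite_type : Prop :=
  let c := (1 - rho)^-1 * (d ord_max - d ord0) in
  exists F : set R,
    [/\ finite_set F, F `<=` [set x | 0 <= x] &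
        forall (n : nat) (s s' : n.-tuple 'I_m.+1), (1 <= n)%N ->
          let t := rho ^- n * `|Sword s 0 - Sword s' 0| in c < t \/ F t].

(* A pair (a, b) stands for the interval [a, b]; `<=` on intervals is inclusion. *)
Definition itv_sub (D E : R * R) : bool :=
  (`[D.1, D.2] <= `[E.1, E.2] :> interval R)%O.

Definition net_points (n : nat) : seq R :=
  sort <=%R (undup ([seq Sword s 0 | s : n.-tuple 'I_m.+1]
                 ++ [seq Sword s 1 | s : n.-tuple 'I_m.+1])).

(* For n = 0 the only word is empty, so that net 0 = [:: (0, 1)]. *)
Definition net (n : nat) : seq (R * R) :=
  let h := net_points n in zip h (behead h).

Definition ell (n : nat) (D : R * R) : R := rho ^- n * (D.2 - D.1).

Definition nbrs (n : nat) (D : R * R) : seq R :=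
  sort <=%R (undup [seq rho ^- n * (D.1 - Sword s 0)
    | s : n.-tuple 'I_m.+1 <- enum {: n.-tuple 'I_m.+1}
    & itv_sub D (Sword s 0, Sword s 1)]).

(* Net intervals are nested, so exactly one E qualifies when supp mu = [0, 1];
   the default value is never used. *)
Definition parent (n : nat) (D : R * R) : R * R :=
  head (0, 1) [seq E <- net n | itv_sub D E].

Definition children (n : nat) (E : R * R) : seq (R * R) :=
  [seq D <- net n.+1 | parent n D == E].

(* position counted from 1, for D in net n.+1 *)
Definition position (n : nat) (D : R * R) : nat :=
  (index D [seq D' <- children n (parent n D) |
     (ell n.+1 D' == ell n.+1 D) && (nbrs n.+1 D' == nbrs n.+1 D)]).+1.

Definition charvec : Type := (R * seq R * nat)%type.

Definition cvec (n : nat) (D : R * R) : charvec :=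
  if n is k.+1 then (ell n D, nbrs n D, position k D) else (1, [:: 0], 1%N).

Definition Omega : set charvec :=
  [set g | exists n D, D \in net n /\ g = cvec n D].

Definition is_child (a b : charvec) : Prop :=
  exists n D, [/\ D \in net n.+1, a = cvec n (parent n D) & b = cvec n.+1 D].

Definition admissible (g : seq charvec) : Prop :=
  (forall a, a \in g -> Omega a) /\ sorted (fun a b => `[< is_child a b >]) g.

Definition loop_class (O : set charvec) : Prop :=
  [/\ O !=set0, O `<=` Omega &
      forall a b, O a -> O b ->
        exists g : seq charvec,
          [/\ admissible g, (2 <= size g)%N, (forall c, c \in g -> O c),
              head a g = a & last b g = b]].

(* By a result of Feng there is exactly one such class. *)
Definition essential_class (O : set charvec) : Prop :=
  loop_class O /\ forall a b, O a -> is_child a b -> O b.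

Definition symbolic_rep (x : R) (g : nat -> charvec) : Prop :=
  exists D : nat -> R * R,
    (forall n, [/\ D n \in net n, x \in `[(D n).1, (D n).2] &
                   parent n (D n.+1) = D n]) /\
    (forall n, g n = cvec n (D n)).

Definition essential_point (x : R) : Prop :=
  exists O, essential_class O /\
    exists g, symbolic_rep x g /\ exists N, forall j, (N <= j)%N -> O (g j).

End IFS.

Section LocalDimension.
Context (R : realType) (mu : probability (measurableTypeR R) R).

Definition msupport : set R :=
  [set x | forall U : set R, open U -> U x -> (0 < mu U)%E].

Definition dim_ratio (x r : R) : R :=
  ln (fine (mu [set` `[x - r, x + r]])) / ln r.

Definition locdim_exists (x : R) : Prop := cvg (dim_ratio x r @[r --> 0^'+]).

Definition locdim (x : R) : R := lim (dim_ratio x r @[r --> 0^'+]).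

End LocalDimension.

(* Main.v *)
Require Import Defs.
From HB Require Import structures.
From mathcomp Require Import all_boot all_order all_algebra.
From mathcomp Require Import all_classical all_reals all_analysis.
From mathcomp Require Import measurable_realfun.
From mathcomp Require Import ring lra.

(** For a word [s] let [W s] be the total weight of the words of the same length defining the
    same map, and [N s] that of the words of the same length whose cylinders touch the cylinder
    of [s]. By finite type, only finitely many relative positions of touching cylinders occur.
    If [tau] has as many of them as possible, the cylinders touching that of [s ++ tau] are the
    images of those touching that of [tau], so that
    [W s * mu I <= mu (S_s I) <= C * N s * mu I] for intervals [I] inside [S_tau [0, 1]]. Every
    cylinder contains a word with [N <= C * W] whose weight is comparable to the mass of the
    cylinder, hence [mu] is almost multiplicative along concatenations [s ++ tau ++ u], and
    alternating greedily between words [u] with large and with small [mu (S_(tau ++ u) [0, 1])]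
    realizes every rate between the two extreme ones.

    Conversely, the loop property places inside [S_tau [0, 1]] a copy of a net interval of any
    essential point [x]: a net interval with the same length and neighbours, on which [mu] is
    comparable. So the rate at [x] lies between the extremes. When [x] is an endpoint of net
    intervals the copy controls one side of [x] only; on the other side each level multiplies
    the mass by [p0 = pm = min p], up to what is seen from the controlled side, and so it
    cannot exceed the upper extreme either. *)

Set Implicit Arguments.
Unset Strict Implicit.
Unset Printing Implicit Defensive.

Import Order.TTheory GRing.Theory Num.Theory.
Import numFieldNormedType.Exports.

Local Open Scope classical_set_scope.
Local Open Scope ring_scope.

Arguments Sword : simpl never.

(** Overlaps are the reason for two weights: a lower bound for the mass inside [S_s [0, 1]] sees the
    words defining the map of [s], an upper bound has to count every word whose cylinder reaches
    there. The two are comparable only for selected words, so the construction moves from one such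
    word to another, at a cost that does not grow with the length. Inserting [tau] has two purposes:
    by rigidity, whatever surrounds the first word meets the second only in positions already
    present around [tau]; and since the cylinder of [tau] avoids 0 and 1, small balls around the
    limit point stay inside the cylinders used.

    In the converse the two bounds differ. Bounding the mass of a ball from below needs one side of
    its centre only, so an endpoint is harmless. Bounding it from above needs both sides, and no
    copy is at hand for the net interval across an endpoint. There the minimality of [p0 = pm]
    enters: in the long run no cost per letter exceeds [- ln p0], so a loss of [p0] per level is at
    least as fast as the decay to be proved. *)

Lemma expr_small (R : realType) (q e : R) : 0 <= q < 1 -> 0 < e ->
  exists n, forall k, (n <= k)%N -> q ^+ k < e.
Proof.
move=> /andP[q0 q1] e0.
have /cvgrPdist_lt/(_ e e0)[n _ nP] : (q ^+ k @[k --> \oo] --> (0 : R)).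
  by apply: cvg_expr; rewrite ger0_norm.
by exists n => k /nP /=; rewrite sub0r normrN ger0_norm // exprn_ge0.
Qed.

Lemma weight_lt1 (R : realType) m (p : 'I_m.+1 -> R) j : (0 < m)%N ->
  (forall j, 0 < p j) -> \sum_j p j = 1 -> p j < 1.
Proof.
move=> m0 p0 <-.
have [i ij] : exists i : 'I_m.+1, i != j.
  have neq : ord_max != ord0 :> 'I_m.+1 by rewrite -(inj_eq val_inj) /= -lt0n.
  by have [->|] := eqVneq j ord0; [exists ord_max | exists ord0; rewrite eq_sym].
rewrite (bigD1 j) //= ltrDl (bigD1 i) //= ltr_pwDl // sumr_ge0 // => k _.
exact: ltW.
Qed.

Lemma min_positive (R : realType) (l : seq R) : exists2 e : R, 0 < e & forall g, g \in l -> 0 < g -> e <= g.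
Proof.
elim: l => [|g l [e e0 el]]; first by exists 1.
case: (ltP 0 g) => g0.
  exists (Num.min e g); first by rewrite lt_min e0 g0.
  move=> u; rewrite inE => /orP[/eqP -> _|ul u1]; first by rewrite ge_min lexx orbT.
  by rewrite ge_min el.
exists e => // u; rewrite inE => /orP[/eqP -> |/el//]; lra.
Qed.

(* [M a b] stands for the mass of the interval [[a, b]]; [mass_mono] includes the absence of mass
   outside the open unit interval. [T] lists the signed rescaled offsets of touching cylinders. *)
Record ifs_setting (R : realType) (m : nat) (rho : R) (d p : 'I_m.+1 -> R)
    (M : R -> R -> R) (T : seq R) : Prop := IfsSetting {
  rho_gt0 : 0 < rho;
  rho_lt1 : rho < 1;
  m_gt0 : (0 < m)%N;
  d_first : d ord0 = 0;
  d_last : d ord_max = 1 - rho;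
  d_incr : forall i j : 'I_m.+1, (i < j)%N -> d i < d j;
  d_cover : forall x, 0 <= x < 1 -> exists j, d j <= x < d j + rho;
  p_gt0 : forall j, 0 < p j;
  p_sum : \sum_j p j = 1;
  p_last : p ord_max = p ord0;
  p_min : forall j, p ord0 <= p j;
  mass_unit : M 0 1 = 1;
  mass_mono : forall a b a' b', (forall z, 0 < z < 1 -> a <= z <= b -> a' <= z <= b') ->
    M a b <= M a' b';
  mass_split : forall a c b, M a b <= M a c + M c b;
  mass_self_similar : forall a b,
    M a b = \sum_j p j * M (rho^-1 * (a - d j)) (rho^-1 * (b - d j));
  mass_empty : M 1 0 = 0;
  offsets : forall s s' : seq 'I_m.+1, size s = size s' ->
    `|Sword rho d s 0 - Sword rho d s' 0| <= rho ^+ size s ->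
    rho ^- size s * (Sword rho d s 0 - Sword rho d s' 0) \in T
}.

(** * Words and their weights *)

Section Words.
Context (R : realType) (m : nat) (rho : R) (d p : 'I_m.+1 -> R).
Context (M : R -> R -> R) (T : seq R) (S : ifs_setting rho d p M T).

Local Notation y s := (Sword rho d s 0).
Local Notation p0 := (p ord0).

Lemma exp_gt0 n : 0 < rho ^+ n.
Proof. by rewrite exprn_gt0 // (rho_gt0 S). Qed.

Lemma exp_le1 n : rho ^+ n <= 1.
Proof. by rewrite exprn_ile1 ?ltW ?(rho_gt0 S) ?(rho_lt1 S). Qed.

Lemma exp_neq0 n : rho ^+ n != 0.
Proof. by rewrite lt0r_neq0 ?exp_gt0. Qed.

Lemma p0_lt1 : p0 < 1.
Proof. exact: weight_lt1 (m_gt0 S) (p_gt0 S) (p_sum S). Qed.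

Lemma p0X_gt0 n : 0 < p0 ^+ n.
Proof. by rewrite exprn_gt0 // (p_gt0 S). Qed.

Lemma Sword_affine s x : Sword rho d s x = y s + rho ^+ size s * x.
Proof.
elim: s => [|j s IH] /=; first by rewrite /Sword /= expr0 mul1r add0r.
by rewrite /Sword /= -/(Sword _ _ _ _) /Smap -/(Sword rho d s x) -/(Sword rho d s 0) IH exprS; ring.
Qed.

Lemma Sword_cat s u x : Sword rho d (s ++ u) x = Sword rho d s (Sword rho d u x).
Proof. exact: foldr_cat. Qed.

Lemma y_cat s u : y (s ++ u) = y s + rho ^+ size s * y u.
Proof. by rewrite Sword_cat Sword_affine. Qed.

Lemma y_cons j s : y (j :: s) = d j + rho * y s.
Proof. by rewrite /Sword /= /Smap addrC. Qed.

Lemma d_ge0 j : 0 <= d j.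
Proof.
rewrite -(d_first S); case: (posnP j) => [j0|j0]; last by rewrite ltW // (d_incr S).
by have -> : j = ord0 by apply/val_inj.
Qed.

Lemma d_le j : d j <= 1 - rho.
Proof.
rewrite -(d_last S); have := leq_ord j; rewrite leq_eqVlt => /orP[/eqP jm|jm].
  by have -> : j = ord_max by apply/val_inj.
by rewrite ltW // (d_incr S).
Qed.

Lemma y_ge0 s : 0 <= y s.
Proof.
elim: s => // j s IH; rewrite y_cons addr_ge0 ?d_ge0 // mulr_ge0 //.
by rewrite ltW // (rho_gt0 S).
Qed.

Lemma y_le s : y s + rho ^+ size s <= 1.
Proof.
elim: s => [|j s IH]; first by rewrite /Sword /= expr0 add0r.
rewrite y_cons /= exprS.
by have := d_le j; have := rho_gt0 S; have := rho_lt1 S; nra.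
Qed.

Lemma cover_word n x : 0 <= x < 1 ->
  exists s : seq 'I_m.+1, size s = n /\ y s <= x < y s + rho ^+ n.
Proof.
elim: n x => [|n IH] x x01; first by exists [::]; rewrite expr0 /Sword /= add0r.
have [j jx] := d_cover S x01.
have r0 := rho_gt0 S.
have x'01 : 0 <= rho^-1 * (x - d j) < 1.
  by rewrite mulrC ler_pdivlMr ?ltr_pdivrMr //; lra.
have [s [sn sx]] := IH _ x'01; exists (j :: s); split; first by rewrite /= sn.
rewrite y_cons exprS.
have xE : x = d j + rho * (rho^-1 * (x - d j)) by rewrite mulVKf ?lt0r_neq0 //; ring.
by move: (rho^-1 * _) sx {x'01} xE => z sx ->; nra.
Qed.

(** The cylinder covering the midpoint has length at most half of [b - a], so it stays inside. *)
Lemma interval_word n a b : 0 <= a -> b <= 1 -> rho ^+ n <= (b - a) / 2 ->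
  exists s : seq 'I_m.+1, [/\ size s = n, a <= y s & y s + rho ^+ n <= b].
Proof.
move=> a0 b1 ab; have rn := exp_gt0 n.
have [|s [sn sx]] := @cover_word n ((a + b) / 2); first by lra.
by exists s; split => //; lra.
Qed.

Lemma exp_small e : 0 < e -> exists n, forall k, (n <= k)%N -> rho ^+ k < e.
Proof. by apply: expr_small; rewrite (rho_lt1 S) ltW // (rho_gt0 S). Qed.

(** Expectation of [f] over words of [n] independent letters of law [p]; the recursion on the first
    letter matches self-similarity. *)
Fixpoint wavg (n : nat) (f : seq 'I_m.+1 -> R) : R :=
  if n is k.+1 then \sum_j p j * wavg k (fun s => f (j :: s)) else f [::].

Lemma eq_wavg n f g : (forall s, size s = n -> f s = g s) -> wavg n f = wavg n g.
Proof.
elim: n f g => [|n IH] f g fg /=; first exact: fg.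
by apply: eq_bigr => j _; congr (_ * _); apply: IH => s sn; rewrite fg //= sn.
Qed.

Lemma wavg_cat n k f : wavg (n + k) f = wavg n (fun s => wavg k (fun u => f (s ++ u))).
Proof. by elim: n f => [|n IH] f //=; apply: eq_bigr => j _; rewrite IH. Qed.

Lemma wavg_mono n f g : (forall s, size s = n -> f s <= g s) -> wavg n f <= wavg n g.
Proof.
elim: n f g => [|n IH] f g fg /=; first exact: fg.
apply: ler_sum => j _; rewrite ler_pM2l ?(p_gt0 S) //.
by apply: IH => s sn; rewrite fg //= sn.
Qed.

Lemma wavgD n f g : wavg n (fun s => f s + g s) = wavg n f + wavg n g.
Proof.
elim: n f g => [|n IH] f g //=; rewrite -big_split /=.
by apply: eq_bigr => j _; rewrite IH mulrDr.
Qed.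

Lemma wavgZ n c f : wavg n (fun s => c * f s) = c * wavg n f.
Proof.
elim: n f => [|n IH] f //=; rewrite mulr_sumr.
by apply: eq_bigr => j _; rewrite IH mulrCA.
Qed.

Lemma wavg_const n c : wavg n (fun=> c) = c.
Proof.
elim: n => [|n IH] //=; under eq_bigr do rewrite IH.
by rewrite -mulr_suml (p_sum S) mul1r.
Qed.

Lemma wavg_ge0 n f : (forall s, size s = n -> 0 <= f s) -> 0 <= wavg n f.
Proof. by move=> f0; rewrite -(wavg_const n 0); exact: wavg_mono. Qed.

Lemma wavg_sum n (I : Type) (r : seq I) (F : I -> seq 'I_m.+1 -> R) :
  wavg n (fun s => \sum_(i <- r) F i s) = \sum_(i <- r) wavg n (F i).
Proof.
elim: r => [|i r IH].
  by rewrite big_nil -[RHS](wavg_const n); apply: eq_wavg => s _; rewrite big_nil.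
by rewrite big_cons -IH -wavgD; apply: eq_wavg => s _; rewrite big_cons.
Qed.

Lemma wavg_ge n f s : (forall u, size u = n -> 0 <= f u) -> size s = n ->
  p0 ^+ n * f s <= wavg n f.
Proof.
elim: n f s => [|n IH] f s f0; first by move/size0nil->; rewrite expr0 mul1r.
case: s => // j s [sn] /=; rewrite (bigD1 j) //= exprS.
have fj0 i u : size u = n -> 0 <= f (i :: u) by move=> un; apply: f0; rewrite /= un.
apply: ler_wpDr.
  apply: sumr_ge0 => i _; apply: mulr_ge0; first by rewrite ltW ?(p_gt0 S).
  by apply: wavg_ge0 => u /(fj0 i).
have H := IH _ _ (fj0 j) sn.
have f1 := f0 (j :: s); rewrite /= sn in f1; have {}f1 := f1 erefl.
rewrite -mulrA; apply: ler_pM => //; first by rewrite ltW ?(p_gt0 S).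
  by rewrite mulr_ge0 // ltW // p0X_gt0.
exact: p_min S _.
Qed.

Lemma mass_null a b : (forall z, 0 < z < 1 -> a <= z <= b -> False) -> M a b = 0.
Proof.
move=> ab; apply/eqP; rewrite eq_le -{1}(mass_empty S).
apply/andP; split; first by apply: (mass_mono S) => z /ab/[apply].
by rewrite -(mass_empty S); apply: (mass_mono S) => z; lra.
Qed.

(** [M 1 0] belongs to an empty interval, so monotonicity puts it below every other mass. *)
Lemma mass_ge0 a b : 0 <= M a b.
Proof. by rewrite -(mass_empty S); apply: (mass_mono S) => z; lra. Qed.

Lemma mass_le1 a b : M a b <= 1.
Proof. by rewrite -(mass_unit S); apply: (mass_mono S) => z; lra. Qed.

Lemma mass_iter n a b :
  M a b = wavg n (fun s => M (rho ^- n * (a - y s)) (rho ^- n * (b - y s))).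
Proof.
elim: n a b => [|n IH] a b /=; first by rewrite /Sword /= expr0 invr1 !mul1r !subr0.
rewrite (mass_self_similar S); apply: eq_bigr => j _; congr (_ * _).
rewrite IH; apply: eq_wavg => s _.
have r0 : rho != 0 by rewrite lt0r_neq0 ?(rho_gt0 S).
by rewrite !y_cons exprS; congr (M _ _); field; rewrite r0 exp_neq0.
Qed.

Lemma mass_word s a b :
  p0 ^+ size s * M a b <= M (y s + rho ^+ size s * a) (y s + rho ^+ size s * b).
Proof.
rewrite (mass_iter (size s) (y s + _)).
have := @wavg_ge (size s) (fun u => M (rho ^- size s * (y s + rho ^+ size s * a - y u))
  (rho ^- size s * (y s + rho ^+ size s * b - y u))) s.
rewrite !(addrC (y s)) !addrK !mulKf ?exp_neq0 //; apply => // u _; exact: mass_ge0.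
Qed.

End Words.

(** * Overlap weights, rigid words and bounded distortion *)

Section Weights.
Context (R : realType) (m : nat) (rho : R) (d p : 'I_m.+1 -> R).
Context (M : R -> R -> R) (T : seq R) (S : ifs_setting rho d p M T).

Local Notation y s := (Sword rho d s 0).
Local Notation p0 := (p ord0).

Definition weight (s : seq 'I_m.+1) : R :=
  wavg p (size s) (fun u => (y u == y s)%R%:R).

Definition near_weight (s : seq 'I_m.+1) : R :=
  wavg p (size s) (fun u => (`|y u - y s| <= rho ^+ size s)%R%:R).

Definition word_mass (s : seq 'I_m.+1) : R := M (y s) (y s + rho ^+ size s).

Lemma le_unscale n a c z : (rho ^- n * (a - c) <= z) = (a <= c + rho ^+ n * z).
Proof. by rewrite mulrC ler_pdivrMr ?(exp_gt0 S) // lerBlDl mulrC. Qed.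

Lemma unscale_le n b c z : (z <= rho ^- n * (b - c)) = (c + rho ^+ n * z <= b).
Proof. by rewrite mulrC ler_pdivlMr ?(exp_gt0 S) // lerBrDl mulrC. Qed.

Lemma weight_le_mass s a b :
  weight s * M a b <= M (y s + rho ^+ size s * a) (y s + rho ^+ size s * b).
Proof.
rewrite (mass_iter S (size s) (y s + _)) mulrC -(wavgZ p).
apply: (wavg_mono S) => u _; case: eqP => [->|_]; last by rewrite mulr0 (mass_ge0 S).
by rewrite !(addrC (y s)) !addrK !mulKf ?(exp_neq0 S) // mulr1.
Qed.

(** Cylinders that meet in one endpoint share no mass, because [M] ignores the ends of the unit
    interval. The strict form matters: only proper overlaps have a length bounded below, on which
    [refine_word] relies. *)
Lemma word_mass_le_overlap s :
  word_mass s <= wavg p (size s) (fun u => (`|y u - y s| < rho ^+ size s)%R%:R).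
Proof.
rewrite /word_mass (mass_iter S (size s)); apply: (wavg_mono S) => u _.
case: ltP => [_|far]; first exact: (mass_le1 S).
rewrite (mass_null S) // => z z01; rewrite le_unscale unscale_le.
have rn := exp_gt0 S (size s); move: far; rewrite ler_normr => far.
by move: (rho ^+ _) rn far => q rn /orP[far|far] /andP[]; nra.
Qed.

Lemma word_mass_le_near s : word_mass s <= near_weight s.
Proof.
apply: le_trans (word_mass_le_overlap s) _; apply: (wavg_mono S) => u _.
by case: ltP => // /ltW ->.
Qed.

Lemma weight_le_word_mass s : weight s <= word_mass s.
Proof.
have := weight_le_mass s 0 1; rewrite (mass_unit S) !mulr1.
by rewrite mulr0 addr0.
Qed.

Lemma weight_ge s : p0 ^+ size s <= weight s.
Proof.
have := @wavg_ge _ _ _ _ _ _ _ S (size s) (fun u => (y u == y s)%R%:R) s.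
by rewrite eqxx mulr1; apply => // u _; exact: ler0n.
Qed.

Lemma weight_gt0 s : 0 < weight s.
Proof. by apply: lt_le_trans (weight_ge s); exact: (p0X_gt0 S). Qed.

Lemma word_mass_gt0 s : 0 < word_mass s.
Proof. by apply: lt_le_trans (weight_le_word_mass s); exact: weight_gt0. Qed.

(** The word [u] need not begin with [s]: words of equal length and equal [y] define the same map,
    and only maps matter. *)
Definition rigid (t : seq 'I_m.+1) : Prop := forall s u,
  size u = (size s + size t)%N ->
  `|y u - y (s ++ t)| <= rho ^+ (size s + size t) ->
  exists v, size v = size t /\ y u = y (s ++ v).

(* A word whose set of relative positions of overlapping cylinders is as large as possible:
   no prefix can then create further overlaps. *)
Lemma rigid_word : exists t, [/\ rigid t, 0 < y t & y t + rho ^+ size t < 1].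
Proof.
(* The prefix [w] puts the cylinder into the middle third, away from 0 and 1; by [offs_cat] it does
   not spoil the maximality of [t0]. *)
have [n0 n0P] := @exp_small _ _ _ _ _ _ _ S (1 / 6) ltac:(lra).
have [|w [wn w1 w2]] := @interval_word _ _ _ _ _ _ _ S n0 (1 / 3) (2 / 3) ltac:(lra) ltac:(lra).
  move: (n0P n0 (leqnn _)) ; lra.
pose offs (s : seq 'I_m.+1) := [seq a <- undup T |
  `[<exists u, [/\ size u = size s, `|a| <= 1 & y u = y s + rho ^+ size s * a]>]].
have uniq_offs s : uniq (offs s) by rewrite filter_uniq // undup_uniq.
have size_offs s : (size (offs s) <= size T)%N.
  by rewrite (leq_trans _ (size_undup T)) // size_filter count_size.
have offs_cat s t : {subset offs t <= offs (s ++ t)}.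
  move=> a; rewrite !mem_filter => /andP[/asboolP[u [us a1 ue]] aT].
  rewrite aT andbT; apply/asboolP; exists (s ++ u); rewrite !size_cat us; split => //.
  by rewrite !y_cat ue exprD; ring.
have [t0 t0max] : exists t0, forall t, (size (offs t) <= size (offs t0))%N.
  have ex : exists n, `[<exists t, size (offs t) = n>].
    by exists (size (offs [::])); apply/asboolP; exists [::].
  have bnd n : `[<exists t, size (offs t) = n>] -> (n <= size T)%N.
    by move/asboolP => [t <-].
  case: (ex_maxnP ex bnd) => n /asboolP[t0 <-] nmax; exists t0 => t.
  by apply: nmax; apply/asboolP; exists t.
exists (w ++ t0); split.
- move=> s u us ule.
  set a := rho ^- (size s + size (w ++ t0)) * (y u - y (s ++ w ++ t0)).
  have ra := exp_gt0 S (size s + size (w ++ t0)).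
  have uE : y u = y (s ++ w ++ t0) + rho ^+ (size s + size (w ++ t0)) * a.
    by rewrite mulVKf ?lt0r_neq0 //; ring.
  have aT : a \in T by rewrite /a -us; apply: (offsets S); rewrite us // !size_cat.
  have a1 : `|a| <= 1.
    by rewrite /a normrM normfV (ger0_norm (ltW ra)) mulrC ler_pdivrMr // mul1r.
  have a_in : a \in offs (s ++ w ++ t0).
    rewrite mem_filter mem_undup aT andbT; apply/asboolP; exists u; rewrite size_cat us.
    by split.
  (* Prefixing can only add offsets, and a set of maximal size admits no new one; so the offset of
     [u] is already realized around [w ++ t0], by some [v]. *)
  have offsE : offs (w ++ t0) =i offs (s ++ w ++ t0).
    have le : (size (offs (s ++ w ++ t0)) <= size (offs (w ++ t0)))%N.
      apply: leq_trans (t0max _) _.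
      exact: uniq_leq_size (uniq_offs _) (offs_cat _ _).
    by have [_ ?] := uniq_min_size (uniq_offs _) (offs_cat s _) le.
  move: a_in; rewrite -offsE mem_filter => /andP[/asboolP[v [vs _ vE]] _].
  exists v; split => //; rewrite uE !y_cat in vE *; rewrite vE size_cat !exprD; ring.
- rewrite y_cat ltr_wpDr ?mulr_ge0 ?(y_ge0 S) ?ltW ?(exp_gt0 S) //; lra.
- have := y_le S t0; have rn := exp_gt0 S (size w); rewrite y_cat size_cat exprD.
  by rewrite wn in rn *; nra.
Qed.

(** In the expansion [size t] levels below [s], rigidity turns every contributing word into the map
    of some [s ++ v]. Its term is then also a term in the expansion of [M a b], where it has weight
    at least [p0 ^+ size t]. *)
Lemma mass_le_near t s a b : rigid t -> y t <= a -> b <= y t + rho ^+ size t ->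
  M (y s + rho ^+ size s * a) (y s + rho ^+ size s * b) <=
  p0 ^- size t * near_weight s * M a b.
Proof.
move=> tr ta bt; rewrite (mass_iter S (size s + size t)) wavg_cat.
rewrite mulrAC -(wavgZ p); apply: (wavg_mono S) => s1 s1n.
rewrite -[leRHS](wavg_const S (size t)); apply: (wavg_mono S) => s2 s2n.
have rs := exp_gt0 S (size s); have rt := exp_gt0 S (size t).
have pt := p0X_gt0 S (size t).
have rhs0 : 0 <= p0 ^- size t * M a b.
  by rewrite mulr_ge0 ?(mass_ge0 S) // invr_ge0 ltW.
case: (leP `|y (s1 ++ s2) - y (s ++ t)| (rho ^+ (size s + size t))) => near.
- have /tr H : size (s1 ++ s2) = (size s + size t)%N by rewrite size_cat s1n s2n.
  have [v [vt vE]] := H near.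
  have -> : `|y s1 - y s| <= rho ^+ size s.
    move: near; rewrite !y_cat s1n exprD !ler_norml.
    have := y_ge0 S s2; have := y_ge0 S t; have := y_le S s2; have := y_le S t; rewrite s2n.
    by move=> ? ? ? ? /andP[? ?]; apply/andP; split; nra.
  rewrite mulr1 vE y_cat exprD.
  have E c : (rho ^+ size s * rho ^+ size t)^-1 * (y s + rho ^+ size s * c - (y s + rho ^+ size s * y v))
    = rho ^- size t * (c - y v) by field; rewrite !(exp_neq0 S).
  rewrite !E [leRHS]mulrC ler_pdivlMr // [leLHS]mulrC.
  have := mass_word S v (rho ^- size t * (a - y v)) (rho ^- size t * (b - y v)).
  by rewrite vt !mulVKf ?(exp_neq0 S) // ![y v + _]addrC !subrK.
- rewrite (mass_null S) => [|z z01]; first by apply: mulr_ge0 => //; exact: ler0n.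
  rewrite le_unscale unscale_le.
  move: near; rewrite (y_cat rho d s t) exprD lter_normr.
  have := ler_wpM2l (ltW rs) ta; have := ler_wpM2l (ltW rs) bt.
  move/andP: z01 => [z0 z1]; have := mulr_gt0 rs rt => r0.
  have := mulr_gt0 r0 z0; have : 0 < rho ^+ size s * rho ^+ size t * (1 - z).
    by rewrite mulr_gt0 // subr_gt0.
  by move=> ? ? ? ? /orP[?|?] /andP[]; lra.
Qed.

Lemma sum_pigeonhole (f : R -> R) A : 0 < A -> A <= \sum_(t <- T) f t ->
  exists2 t, t \in T & A <= (size T)%:R * f t.
Proof.
move=> A0 AT; apply: contrapT => no.
have lt t : t \in T -> (size T)%:R * f t < A.
  by move=> tT; rewrite ltNge; apply/negP => h; apply: no; exists t.
have T0 : (0 < size T)%N.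
  by case: (T) AT => // ; rewrite big_nil; lra.
have TR : 0 < (size T)%:R :> R by rewrite ltr0n.
suff : \sum_(t <- T) f t < A by lra.
have -> : A = \sum_(t <- T) A / (size T)%:R.
  by rewrite big_const_seq count_predT iter_addr_0 -[X in _ = X]mulr_natr divfK // lt0r_neq0.
rewrite big_seq [ltRHS]big_seq; apply: ltr_sum.
  by case: (T) T0 => // t l _; apply/hasP; exists t; rewrite mem_head.
by move=> t /lt; rewrite mulrC ltr_pdivlMr.
Qed.

(** Two cylinders at offset [t] overlap in the relative length [1 - |t|], and finitely many offsets
    leave a least positive one. *)
Lemma overlap_gap : exists2 e : R, 0 < e & forall t, t \in T -> `|t| < 1 -> e <= 1 - `|t|.
Proof.
have [e e0 eP] := min_positive [seq 1 - `|t| | t <- T]; exists e => // t tT t1.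
by apply: eP; rewrite ?subr_gt0 // (map_f (fun t => 1 - `|t|)).
Qed.

(* Among the cylinders overlapping that of [s], take the heaviest and go deep into the overlap. *)
Lemma refine_word : exists k (c C : R), [/\ 0 < c, 0 < C & forall s, exists u,
  [/\ size u = (size s + k)%N, y s <= y u & y u + rho ^+ size u <= y s + rho ^+ size s] /\
  near_weight u <= C * weight u /\ c * word_mass s <= weight u].
Proof.
have [e e0 eT] := overlap_gap.
have [k kP] := @exp_small _ _ _ _ _ _ _ S (e / 4) ltac:(lra).
have {kP}rk := kP k (leqnn k); have rk0 := exp_gt0 S k.
have pk := p0X_gt0 S k.
(* The overlapping words are sorted by offset: some class carries at least the fraction [1 / size T]
   of their total weight. *)
have A_sum s : wavg p (size s) (fun u => (`|y u - y s| < rho ^+ size s)%R%:R) <=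
    \sum_(t <- T) wavg p (size s)
       (fun u => ((y u == y s + rho ^+ size s * t) && (`|t| < 1))%R%:R).
  rewrite -(wavg_sum S); apply: (wavg_mono S) => u us.
  case: ltP => [lt|_]; last by rewrite sumr_ge0.
  set t := rho ^- size s * (y u - y s).
  have tT : t \in T by rewrite /t -us; apply: (offsets S) => //; rewrite us ltW.
  have t1 : `|t| < 1.
    rewrite /t normrM normfV (ger0_norm (ltW (exp_gt0 S _))) mulrC.
    by rewrite ltr_pdivrMr ?mul1r ?(exp_gt0 S).
  rewrite (big_rem t) //= t1 andbT mulVKf ?(exp_neq0 S) // subrKC eqxx.
  by rewrite lerDl sumr_ge0.
have KT : 0 < (size T)%:R :> R.
  rewrite ltr0n; have := A_sum [::]; case: (T) => // .
  by rewrite big_nil /= subrr normr0 expr0 ltr01 ler10.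
exists k, (p0 ^+ k / (size T)%:R), ((size T)%:R / p0 ^+ k); split; [exact: divr_gt0| exact: divr_gt0 | move=> s].
set A := wavg p (size s) (fun u => (`|y u - y s| < rho ^+ size s)%R%:R) in A_sum.
have rs := exp_gt0 S (size s).
have A0 : 0 < A.
  have := @wavg_ge _ _ _ _ _ _ _ S (size s) (fun u => (`|y u - y s| < rho ^+ size s)%R%:R) s.
  rewrite subrr normr0 rs mulr1 => h; apply: lt_le_trans (h _ _) => //; exact: (p0X_gt0 S).
have [t tT At] := sum_pigeonhole A0 (A_sum s).
have [s' [s'n s'E t1]] : exists s', [/\ size s' = size s, y s' = y s + rho ^+ size s * t & `|t| < 1].
  apply: contrapT => no; move: At; rewrite (_ : wavg _ _ _ = 0) ?mulr0; first lra.
  rewrite -[RHS](wavg_const S (size s)); apply: eq_wavg => u un.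
  case: andP => // -[/eqP uE t1]; case: no; by exists u.
have AW : A <= (size T)%:R * weight s'.
  apply: le_trans At _; rewrite ler_pM2l // /weight s'n; apply: (wavg_mono S) => u _.
  by rewrite -s'E; case: eqP => //= _; case: (_ < _).
have et := eT _ tT t1; move: (t1); rewrite ltr_norml => /andP[t1' t1''].
(* In the coordinates of [s'], [[a, b]] is the overlap with the cylinder of [s] shrunk by [e / 4] at
   both ends; half its length is still at least [e / 4], hence above [rho ^+ k]. By the margin, any
   word touching [s' ++ u] has a prefix properly overlapping [s], so [near_weight (s' ++ u)] is at
   most [A]. *)
have [a [b [a0 b1 ab [at0 bt0]]]] : exists a b, [/\ 0 <= a, b <= 1, rho ^+ k <= (b - a) / 2 & -t + e / 4 <= a /\ b <= 1 - t - e / 4 ].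
  case: (leP 0 t) => t0.
    by exists (e / 4), (1 - t - e / 4); rewrite ger0_norm // in et; repeat split; lra.
  by exists (- t + e / 4), (1 - e / 4); rewrite ltr0_norm // in et; repeat split; lra.
have [u [uk au ub]] := interval_word S a0 b1 ab.
have Wu : p0 ^+ k * weight s' <= weight (s' ++ u).
  rewrite /weight size_cat wavg_cat uk -(wavgZ p); apply: (wavg_mono S) => s1 s1n.
  have h f := @wavg_ge _ _ _ _ _ _ _ S k f u.
  apply: le_trans (h _ _ uk); last by move=> *; exact: ler0n.
  rewrite (ler_pM2l pk) !y_cat s1n; case: (y s1 =P y s') => [->|_]; last exact: ler0n.
  by rewrite eqxx.
have ule := y_le S u; rewrite uk in ule.
have y0 := y_ge0 S u.
exists (s' ++ u); split; first split.
- by rewrite size_cat s'n uk.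
- by rewrite y_cat s'n s'E; nra.
- rewrite size_cat y_cat s'n s'E uk exprD; nra.
have near_A : near_weight (s' ++ u) <= A.
  rewrite /near_weight size_cat wavg_cat s'n uk; apply: (wavg_mono S) => s1 s1n.
  rewrite -[leRHS](wavg_const S k); apply: (wavg_mono S) => s2 s2n.
  case: (leP `|y (s1 ++ s2) - y (s' ++ u)|) => // near.
  suff -> : `|y s1 - y s| < rho ^+ size s by [].
  move: near; rewrite !y_cat s1n s'n s'E exprD ler_norml ltr_norml.
  have := y_ge0 S s2; have := y_le S s2; rewrite s2n => ? ? /andP[? ?]; apply/andP; split; nra.
split.
  rewrite (le_trans near_A) // (le_trans AW) // mulrAC -mulrA ler_pM2l // ler_pdivlMr //.
  by rewrite mulrC.
apply: le_trans Wu; rewrite -mulrA ler_pM2l // mulrC ler_pdivrMr // mulrC.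
by apply: le_trans AW; exact: word_mass_le_overlap.
Qed.

End Weights.

(** * Rates realized by greedy concatenation *)

Lemma natr_bound (R : realType) (x : R) : exists n : nat, x <= n%:R.
Proof. by exists (Num.truncn x).+1; rewrite ltW // truncnS_gt. Qed.

(** The value [kappa n] is the largest [k <= n] with [k.+1 * B k <= n], and 0 if there is none. It
    tends to infinity so slowly that [B (kappa n)] remains a vanishing fraction of [n]. *)
Lemma diagonal_index (B : nat -> nat) : exists kappa : nat -> nat, forall K n,
  (K <= n)%N -> (K.+1 * B K <= n)%N -> (K <= kappa n)%N /\ ((kappa n).+1 * B (kappa n) <= n)%N.
Proof.
have ex n : exists k, forall K, (K <= n)%N -> (K.+1 * B K <= n)%N ->
    (K <= k)%N /\ (k.+1 * B k <= n)%N.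
  case: (pselect (exists k, (k <= n)%N && (k.+1 * B k <= n)%N)) => [exk|no].
    have ub k : (k <= n)%N && (k.+1 * B k <= n)%N -> (k <= n)%N by move=> /andP[].
    case: (ex_maxnP exk ub) => k /andP[_ kP] kmax; exists k => K Kn KP; split => //.
    by apply: kmax; rewrite Kn.
  by exists 0%N => K Kn KP; case: no; exists K; rewrite Kn.
by have [f fP] := choice ex; exists f => K n; exact: fP.
Qed.

(* A greedy process whose error [V] can be kept below [eps * length] with steps of bounded length,
   for each [eps], can be run with [eps] tending to [0]. *)
Lemma slow_process (R : realType) (X : Type) (len : X -> nat) (V : X -> R)
    (good : X -> Prop) (step : X -> X -> Prop) (x0 : X) : good x0 ->
  (forall e : R, 0 < e -> exists B : nat, forall s, good s -> exists s',
    [/\ good s', step s s', (len s < len s' <= len s + B)%N &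
        `|V s'| <= Num.max (`|V s| + e * ((len s')%:R - (len s)%:R)) B%:R]) ->
  exists f : nat -> X, (forall i, [/\ good (f i), step (f i) (f i.+1) & (len (f i) < len (f i.+1))%N]) /\
  forall e : R, 0 < e -> exists N, forall i, (N <= i)%N ->
    (len (f i.+1))%:R - (len (f i))%:R <= e * (len (f i))%:R /\ `|V (f i)| <= e * (len (f i))%:R.
Proof.
move=> gx0 greedy.
have /choice[B BP] : forall k : nat, exists B : nat, forall s, good s -> exists s',
    [/\ good s', step s s', (len s < len s' <= len s + B)%N &
        `|V s'| <= Num.max (`|V s| + k.+1%:R^-1 * ((len s')%:R - (len s)%:R)) B%:R].
  by move=> k; apply: greedy; rewrite invr_gt0 ltr0n.
have [kappa kappaP] := diagonal_index B.
(* The tolerance used depends on the current length through [kappa], and so tends to 0 along the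
   run. *)
have /choice[next nextP] : forall s, exists s', good s ->
    [/\ good s', step s s', (len s < len s' <= len s + B (kappa (len s)))%N &
        `|V s'| <= Num.max (`|V s| + (kappa (len s)).+1%:R^-1 * ((len s')%:R - (len s)%:R))
                           (B (kappa (len s)))%:R].
  move=> s; case: (pselect (good s)) => [gs|ngs]; last by exists s.
  by have [s' ?] := BP (kappa (len s)) s gs; exists s'.
pose f i := iter i next x0.
have fg i : good (f i) by elim: i => //= i IH; case: (nextP _ IH).
have fP i := nextP _ (fg i).
exists f; split=> [i|e e0].
  by have [? ? /andP[? ?] _] := fP i.
have len_ge i : (i <= len (f i))%N.
  by elim: i => // i IH; have [_ _ /andP[h _] _] := fP i; apply: leq_ltn_trans IH h.
have [K KP] : exists K : nat, K.+1%:R^-1 <= e / 2.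
  have [K Ke] := natr_bound (2 / e); exists K.
  rewrite invf_ple ?posrE ?ltr0n ?divr_gt0 // invf_div (le_trans Ke) //.
  by rewrite ler_nat.
set q : R := K.+1%:R^-1 in KP.
have q0 : 0 < q by rewrite invr_gt0 ltr0n.
pose N0 := maxn K (K.+1 * B K).
have late i : (N0 <= i)%N ->
    (len (f i.+1))%:R - (len (f i))%:R <= q * (len (f i))%:R /\
    `|V (f i.+1)| <= Num.max (`|V (f i)| + q * ((len (f i.+1))%:R - (len (f i))%:R)) (q * (len (f i))%:R).
  rewrite geq_max => /andP[Ki BKi].
  have [|| kK kB] := kappaP K (len (f i)); try by rewrite (leq_trans _ (len_ge i)).
  have [_ _ /andP[lt le] Vi] := fP i.
  have Bq : (B (kappa (len (f i))))%:R <= q * (len (f i))%:R.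
    rewrite mulrC ler_pdivlMr ?ltr0n // -natrM ler_nat mulnC (leq_trans _ kB) //.
    by rewrite leq_mul2r ltnS kK orbT.
  have lt' : (len (f i))%:R < (len (f i.+1))%:R :> R by rewrite ltr_nat.
  have le' : (len (f i.+1))%:R <= (len (f i))%:R + (B (kappa (len (f i))))%:R :> R.
    by rewrite -natrD ler_nat.
  have kq : (kappa (len (f i))).+1%:R^-1 <= q.
    by rewrite lef_pV2 ?posrE ?ltr0n // ler_nat ltnS.
  split; first by lra.
  apply: le_trans Vi _; rewrite ge_max !le_max Bq orbT andbT lerD2l ler_wpM2r //.
  by rewrite subr_ge0 ltW.
(* The increments telescope: the error is at most [q] times the length plus its value at [N0]. That
   value is absorbed from [N1] on, which is why [q] was taken below [e / 2]. *)
have bound i : `|V (f (N0 + i)%N)| <= q * (len (f (N0 + i)%N))%:R + `|V (f N0)|.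
  elim: i => [|i IH]; first by rewrite addn0 lerDr mulr_ge0 // ltW.
  have [_ h] := late (N0 + i)%N (leq_addr _ _); rewrite addnS (le_trans h) //.
  have [_ _ /andP[lt _] _] := fP (N0 + i)%N.
  have lt' : (len (f (N0 + i)%N))%:R < (len (f (N0 + i).+1))%:R :> R by rewrite ltr_nat.
  rewrite ge_max; apply/andP; split; first by lra.
  by rewrite ler_wpDr ?normr_ge0 // ler_pM2l // ltW.
have [N1 N1P] := natr_bound (q^-1 * `|V (f N0)|).
exists (maxn N0 N1) => i; rewrite geq_max => /andP[N0i N1i].
have l0 : 0 <= (len (f i))%:R :> R by [].
split; first by have [h _] := late i N0i; nra.
have := bound (i - N0)%N; rewrite subnKC //.
have : `|V (f N0)| <= q * (len (f i))%:R.
  rewrite -ler_pdivrMl // (le_trans N1P) // ler_nat.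
  exact: leq_trans N1i (len_ge i).
nra.
Qed.

(** The local dimension multiplied by [- ln rho], seen along the radii [rho ^+ n]. *)
Definition decay_rate (R : realType) (rho : R) (M : R -> R -> R) (x t : R) : Prop :=
  forall e, 0 < e -> exists N, forall n, (N <= n)%N ->
    `|- ln (M (x - rho ^+ n) (x + rho ^+ n)) - t * n%:R| <= e * n%:R.

Section Rates.
Context (R : realType) (m : nat) (rho : R) (d p : 'I_m.+1 -> R).
Context (M : R -> R -> R) (T : seq R) (S : ifs_setting rho d p M T).
Context (tau : seq 'I_m.+1).

Local Notation y s := (Sword rho d s 0).
Local Notation p0 := (p ord0).

Definition cost (u : seq 'I_m.+1) : R := - ln (word_mass rho d M (tau ++ u)).

(** It says that [t] is at least the lower limit of [cost u / size u] for long [u]; [dear_rate] says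
    that [t] is at most the upper limit. *)
Definition cheap_rate (t : R) : Prop := forall e, 0 < e -> forall n,
  exists u, (n <= size u)%N /\ cost u <= (t + e) * (size u)%:R.

Definition dear_rate (t : R) : Prop := forall e, 0 < e -> forall n,
  exists u, (n <= size u)%N /\ (t - e) * (size u)%:R <= cost u.

Lemma cost_ge0 u : 0 <= cost u.
Proof. by rewrite /cost oppr_ge0 ln_le0 // (mass_le1 S). Qed.

Lemma cost_le u : cost u <= - ln p0 * (size tau + size u)%:R.
Proof.
rewrite /cost mulNr lerN2 mulr_natr -lnXn ?(p_gt0 S) // ler_ln ?posrE ?(p0X_gt0 S) ?(word_mass_gt0 S) //.
by rewrite -size_cat (le_trans (weight_ge S _)) // (weight_le_word_mass S).
Qed.

Lemma lnp0_lt0 : ln p0 < 0.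
Proof. by rewrite ln_lt0 // (p_gt0 S) (p0_lt1 S). Qed.

(** The bounds are the lower and upper limits of [cost u / size u]. They are finite because the cost
    lies between 0 and [- ln p0] per letter, up to the fixed prefix [tau]. *)
Lemma rates_interval : exists A B, A <= B /\
  forall t, (cheap_rate t /\ dear_rate t) <-> A <= t <= B.
Proof.
set P := - ln p0; have P0 : 0 < P by rewrite oppr_gt0 lnp0_lt0.
have cost_hi u : (size tau < size u)%N -> cost u <= (2 * P) * (size u)%:R.
  move=> /ltnW lt; apply: le_trans (cost_le u) _; rewrite -/P natrD.
  have : (size tau)%:R <= (size u)%:R :> R by rewrite ler_nat.
  nra.
have cheap_hi : cheap_rate (2 * P).
  move=> e e0 n; exists (nseq (maxn n (size tau).+1) ord0); rewrite size_nseq leq_maxl.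
  split=> //; apply: le_trans (cost_hi _ _) _; rewrite size_nseq ?leq_maxr //.
  by rewrite ler_wpM2r // lerDl ltW.
have cheap_lo t : cheap_rate t -> 0 <= t.
  move=> ct; rewrite leNgt; apply/negP => t0.
  have [|u [u1 uP]] := ct (- t / 2) _ 1%N; first by lra.
  have := cost_ge0 u; have : 0 < (size u)%:R :> R by rewrite ltr0n.
  nra.
have dear_hi t : dear_rate t -> t <= 2 * P.
  move=> dt; rewrite leNgt; apply/negP => t0.
  have [|u [u1 uP]] := dt ((t - 2 * P) / 2) _ (size tau).+1; first by lra.
  have := cost_hi u u1; have : 0 < (size u)%:R :> R by rewrite ltr0n (leq_trans _ u1).
  nra.
pose A := inf [set t | cheap_rate t].
have A_lb : has_lbound [set t | cheap_rate t] by exists 0 => t /cheap_lo.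
have neA : [set t | cheap_rate t] !=set0 by exists (2 * P).
have cheapP t : cheap_rate t <-> A <= t.
  split=> [ct|At e e0 n]; first exact: ge_inf.
  have [t' ct' t'A] := inf_adherent (eps := e / 2) ltac:(lra) (conj neA A_lb).
  have [|u [un uP]] := ct' (e / 2) _ n; first by lra.
  exists u; split => //; apply: le_trans uP _; rewrite ler_wpM2r //.
  rewrite -/A in t'A; lra.
(* Otherwise every long word would cost less than [A - e] per letter, and [A - e] would be cheap. *)
have dearA : dear_rate A.
  move=> e e0 n; apply: contrapT => no.
  have /cheapP : cheap_rate (A - e).
    move=> e' e'0 n'; exists (nseq (maxn n n') ord0); rewrite size_nseq leq_maxr; split => //.
    rewrite leNgt; apply/negP => h; apply: no; exists (nseq (maxn n n') ord0).
    rewrite size_nseq leq_maxl; split => //; apply: ltW; apply: le_lt_trans h.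
    by rewrite ler_wpM2r // lerDl ltW.
  lra.
pose B := sup [set t | dear_rate t].
have B_ub : has_ubound [set t | dear_rate t] by exists (2 * P) => t /dear_hi.
have neB : [set t | dear_rate t] !=set0 by exists A.
have dearP t : dear_rate t <-> t <= B.
  split=> [ct|At e e0 n]; first exact: ub_le_sup.
  have [t' ct' t'A] := sup_adherent (eps := e / 2) ltac:(lra) (conj neB B_ub).
  have [|u [un uP]] := ct' (e / 2) _ n; first by lra.
  exists u; split => //; apply: le_trans uP; rewrite ler_wpM2r //.
  rewrite -/B in t'A; lra.
exists A, B; split; first by apply/dearP.
by move=> t; rewrite cheapP dearP; split => [[-> ->]|/andP[]].
Qed.

Context (tau_rigid : rigid rho d tau)
  (tau_gt0 : 0 < y tau)
  (tau_lt1 : y tau + rho ^+ size tau < 1).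

(** Stronger than nesting: the cylinder of [s'] keeps a positive relative distance from both ends of
    the cylinder of [s]. *)
Definition inside (s s' : seq 'I_m.+1) : Prop :=
  y s + rho ^+ size s * y tau <= y s' /\
  y s' + rho ^+ size s' <= y s + rho ^+ size s * (y tau + rho ^+ size tau).

(** When [near_weight s] and [weight s] are comparable, the mass of [s ++ tau ++ u] is [weight s]
    times that of [tau ++ u] up to constants: [weight_le_mass] gives one side, [mass_le_near] the
    other. Refining the concatenation makes the two weights comparable again, and costs a bounded
    factor. *)
Lemma good_step : exists (k : nat) (C D : R), [/\ 0 < C, 0 <= D,
  exists s, near_weight rho d p s <= C * weight rho d p s &
  forall s u, near_weight rho d p s <= C * weight rho d p s -> exists s',
    [/\ near_weight rho d p s' <= C * weight rho d p s', inside s s',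
        size s' = (size s + (size u + k))%N &
        `|- ln (weight rho d p s') - (- ln (weight rho d p s) + cost u)| <= D]].
Proof.
have [k [c [C [c0 C0 refine]]]] := refine_word S.
have pk := p0X_gt0 S (size tau).
exists (size tau + k)%N, C, (`|ln c| + `|ln (C / p0 ^+ size tau)|); split => //.
  by have [s [_ [gs _]]] := refine [::]; exists s.
move=> s u gs.
have [s' [[s's ys' s'y] [gs' ws']]] := refine (s ++ tau ++ u).
have rs := exp_gt0 S (size s).
have y0 := y_ge0 S u; have y1 := y_le S u; have rt := exp_gt0 S (size tau).
exists s'; split => //.
- have rst := mulr_gt0 rs rt; have := mulr_ge0 (ltW rst) y0.
  have := ler_wpM2l (ltW rst) y1 => h1 h0.
  split; first by apply: le_trans ys'; rewrite !y_cat; lra.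
  by apply: le_trans s'y _; rewrite !y_cat !size_cat !exprD; lra.
- by rewrite s's !size_cat -!addnA (addnCA (size tau)).
have lnw_lo : ln (weight rho d p s) - cost u + ln c <= ln (weight rho d p s').
  rewrite opprK -!lnM ?posrE ?mulr_gt0 ?(weight_gt0 S) ?(word_mass_gt0 S) //.
  rewrite ler_ln ?posrE ?mulr_gt0 ?(weight_gt0 S) ?(word_mass_gt0 S) //.
  apply: le_trans ws'; rewrite mulrC ler_pM2l //.
  rewrite [leRHS]/word_mass y_cat size_cat exprD -addrA -mulrDr.
  exact: (weight_le_mass S).
have lnw_hi : ln (weight rho d p s') <= ln (weight rho d p s) - cost u + ln (C / p0 ^+ size tau).
  rewrite opprK -!lnM ?posrE ?mulr_gt0 ?invr_gt0 ?(weight_gt0 S) ?(word_mass_gt0 S) //.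
  rewrite ler_ln ?posrE ?mulr_gt0 ?invr_gt0 ?(weight_gt0 S) ?(word_mass_gt0 S) //.
  apply: le_trans (weight_le_word_mass S _) _.
  apply: (@le_trans _ _ (word_mass rho d M (s ++ tau ++ u))).
    apply: (mass_mono S) => z _; move: ys' s'y; lra.
  rewrite [leLHS]/word_mass y_cat size_cat exprD -addrA -mulrDr.
  apply: le_trans (mass_le_near S s tau_rigid _ _) _.
  - by rewrite y_cat lerDl mulr_ge0 // ltW.
  - by rewrite y_cat size_cat exprD -addrA lerD2l; nra.
  rewrite [leRHS]mulrAC ler_pM2r ?(word_mass_gt0 S) //.
  by rewrite mulrC mulrA ler_pM2r ?invr_gt0 // mulrC.
have c1 := ler_norm (ln c); have := ler_norm (- ln c).
have c2 := ler_norm (ln (C / p0 ^+ size tau)); have := ler_norm (- ln (C / p0 ^+ size tau)).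
rewrite !normrN => c3 c4. rewrite ler_norml; apply/andP; split; lra.
Qed.

(* Greedy choice: cheap blocks while the accumulated cost is above [t] times the length,
   dear blocks while it is below. *)
Lemma good_words t : cheap_rate t -> dear_rate t -> exists C (f : nat -> seq 'I_m.+1),
  [/\ 0 < C, forall i, near_weight rho d p (f i) <= C * weight rho d p (f i),
      forall i, inside (f i) (f i.+1), forall i, (size (f i) < size (f i.+1))%N &
  forall e, 0 < e -> exists N, forall i, (N <= i)%N ->
    (size (f i.+1))%:R - (size (f i))%:R <= e * (size (f i))%:R /\
    `|- ln (weight rho d p (f i)) - t * (size (f i))%:R| <= e * (size (f i))%:R].
Proof.
move=> ct dt; have [k [C [D [C0 D0 [s0 gs0] step]]]] := good_step.
pose V s := - ln (weight rho d p s) - t * (size s)%:R.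
have greedy (e : R) : 0 < e -> exists B : nat, forall s, near_weight rho d p s <= C * weight rho d p s ->
    exists s', [/\ near_weight rho d p s' <= C * weight rho d p s', inside s s',
      (size s < size s' <= size s + B)%N &
      `|V s'| <= Num.max (`|V s| + e * ((size s')%:R - (size s)%:R)) B%:R].
  move=> e0.
  (* Blocks longer than [n] spread the fixed overhead of a step over their letters, at most [e / 2]
     each; the other [e / 2] is the tolerance of the cheap and dear words. *)
  have [n nP] := natr_bound (2 / e * (D + `|t| * k%:R)).
  have e2 : 0 < e / 2 by lra.
  have [u [un uP]] := ct _ e2 n.+1; have [v [vn vP]] := dt _ e2 n.+1.
  pose b w : R := `|cost w - t * (size w)%:R| + D + `|t| * k%:R.
  have [B BP] := natr_bound (Num.max (b u) (b v)).
  have D_le (w : seq 'I_m.+1) : (n < size w)%N -> D + `|t| * k%:R <= e / 2 * (size w)%:R.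
    move=> wn; have : n%:R <= (size w)%:R :> R by rewrite ler_nat ltnW.
    rewrite -invf_div -ler_pdivrMl ?invrK ?invf_div ?divr_gt0 // => h.
    exact: le_trans nP h.
  have big (w : seq 'I_m.+1) : (size w <= maxn (size u) (size v))%N ->
      (size w + k <= maxn (size u) (size v) + k + B)%N.
    by move=> wn; rewrite -addnA leq_add // leq_addr.
  have tk : `|t * k%:R| = `|t| * k%:R by rewrite normrM [`|k%:R|]ger0_norm.
  exists (maxn (size u) (size v) + k + B)%N => s gs.
  have BB : B%:R <= (maxn (size u) (size v) + k + B)%:R :> R by rewrite ler_nat leq_addl.
  have := ler_norm (t * k%:R); have := ler_norm (- (t * k%:R)); rewrite normrN tk => t1 t2.
  move: BP; rewrite ge_max => /andP[Bu Bv].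
  have Vs := ler_norm (V s); have := ler_norm (- V s); rewrite normrN => Vs'.
  (* If [V] keeps its sign, its size grows by at most [e] per added letter; if the sign changes, its
     size is at most the change in this one step, hence at most [B]. *)
  case: (leP 0 (V s)) => Vs0.
  - have [s' [gs' ins s'n]] := step s u gs; rewrite ler_norml => /andP[s'1 s'2].
    have VE : V s' - V s = - ln (weight rho d p s') - (- ln (weight rho d p s) + cost u)
      + (cost u - t * (size u)%:R) - t * k%:R by rewrite /V s'n !natrD; ring.
    exists s'; split => //.
      by rewrite s'n leq_add2l big ?leq_maxl // andbT -addn1 leq_add2l addn_gt0 (leq_trans _ un).
    have eu := D_le u un; have cu := ler_norm (- (cost u - t * (size u)%:R)).
    rewrite normrN in cu; rewrite /b in Bu.
    rewrite le_max ler_norml ler_norml s'n !natrD; apply/orP.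
    case: (leP 0 (V s')) => Vs'0; [left|right]; apply/andP; split.
    + have k0 : 0 <= k%:R :> R by []; have u0 : 0 <= (size u)%:R :> R by [].
      have : 0 <= e * ((size s)%:R + ((size u)%:R + k%:R) - (size s)%:R) by apply: mulr_ge0; [exact: ltW | lra].
      have := normr_ge0 (V s); lra.
    + have k0 : 0 <= e * k%:R by rewrite mulr_ge0 // ltW.
      lra.
    + rewrite !natrD in BB; lra.
    + rewrite !natrD in BB; have B0 : 0 <= B%:R :> R by []; lra.
  - have [s' [gs' ins s'n]] := step s v gs; rewrite ler_norml => /andP[s'1 s'2].
    have VE : V s' - V s = - ln (weight rho d p s') - (- ln (weight rho d p s) + cost v)
      + (cost v - t * (size v)%:R) - t * k%:R by rewrite /V s'n !natrD; ring.
    exists s'; split => //.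
      by rewrite s'n leq_add2l big ?leq_maxr // andbT -addn1 leq_add2l addn_gt0 (leq_trans _ vn).
    have ev := D_le v vn; have cv := ler_norm (cost v - t * (size v)%:R).
    rewrite /b in Bv.
    rewrite le_max ler_norml ler_norml s'n !natrD; apply/orP.
    case: (leP 0 (V s')) => Vs'0; [right|left]; apply/andP; split.
    + rewrite !natrD in BB; have B0 : 0 <= B%:R :> R by []; lra.
    + rewrite !natrD in BB; lra.
    + have k0 : 0 <= e * k%:R by rewrite mulr_ge0 // ltW.
      lra.
    + have k0 : 0 <= k%:R :> R by []; have v0 : 0 <= (size v)%:R :> R by [].
      have : 0 <= e * ((size s)%:R + ((size v)%:R + k%:R) - (size s)%:R) by apply: mulr_ge0; [exact: ltW | lra].
      have := normr_ge0 (V s); lra.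
have [f [fP fV]] := slow_process
  (good := fun s => near_weight rho d p s <= C * weight rho d p s) gs0 greedy.
exists C, f; split => // [i|i|i]; by have [] := fP i.
Qed.

Lemma inside_limit (f : nat -> seq 'I_m.+1) : (forall i, inside (f i) (f i.+1)) ->
  exists x, forall i, y (f i) + rho ^+ size (f i) * y tau <= x <=
    y (f i) + rho ^+ size (f i) * (y tau + rho ^+ size tau).
Proof.
move=> ins.
have mono i : y (f i) <= y (f i.+1) /\
    y (f i.+1) + rho ^+ size (f i.+1) <= y (f i) + rho ^+ size (f i).
  have [? ?] := ins i; have ri := exp_gt0 S (size (f i)).
  by have := mulr_gt0 ri tau_gt0; have := ler_wpM2l (ltW ri) (ltW tau_lt1); split; lra.
have monol i j : y (f i) <= y (f (i + j)%N).
  by elim: j => [|j IH]; rewrite ?addn0 // addnS (le_trans IH) //; have [] := mono (i + j)%N.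
have monor i j : y (f (i + j)%N) + rho ^+ size (f (i + j)%N) <= y (f i) + rho ^+ size (f i).
  by elim: j => [|j IH]; rewrite ?addn0 // addnS (le_trans _ IH) //; have [] := mono (i + j)%N.
have below i j : y (f j) <= y (f i) + rho ^+ size (f i).
  case/orP: (leq_total i j) => ij; last first.
    have := monol j (i - j)%N; rewrite subnKC //; have := exp_gt0 S (size (f i)); lra.
  have := monor i (j - i)%N; rewrite subnKC //; have := exp_gt0 S (size (f j)); lra.
pose x := sup (range (fun i => y (f i))).
have ne : range (fun i => y (f i)) !=set0 by exists (y (f 0%N)), 0%N.
have lex i : y (f i) <= x.
  by apply: ub_le_sup; [exists (y (f 0%N) + rho ^+ size (f 0%N)) => _ [j _ <-] | exists i].
have xle i : x <= y (f i) + rho ^+ size (f i) by apply: ge_sup => // _ [j _ <-].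
exists x => i; have [h1 h2] := ins i.
by rewrite (le_trans h1) // (le_trans _ h2).
Qed.

Lemma index_between (f : nat -> nat) n : (forall i, (f i < f i.+1)%N) -> (f 0 <= n)%N ->
  exists i, (f i <= n < f i.+1)%N.
Proof.
move=> fS f0; have fi i : (i <= f i)%N.
  by elim: i => // i IH; apply: leq_ltn_trans IH (fS i).
have ex : exists i, (f i <= n)%N by exists 0%N.
case: (ex_maxnP ex (m := n)) => [i|i fin imax]; first exact: leq_trans.
by exists i; rewrite fin ltnNge; apply/negP => /imax; rewrite ltnn.
Qed.

Lemma rate_attained t : cheap_rate t -> dear_rate t ->
  exists x, 0 <= x <= 1 /\ decay_rate rho M x t.
Proof.
move=> ct dt; have [C [f [C0 gf ins sz fV]]] := good_words ct dt.
have [x xP] := inside_limit ins.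
have x_in i : y (f i) <= x <= y (f i) + rho ^+ size (f i).
  have := xP i; have ri := exp_gt0 S (size (f i)); have := mulr_gt0 ri tau_gt0.
  by have := ler_wpM2l (ltW ri) (ltW tau_lt1) => ? ? /andP[? ?]; apply/andP; split; lra.
exists x; split.
  by have /andP[? ?] := x_in 0%N; have := y_ge0 S (f 0%N); have := y_le S (f 0%N); lra.
pose g n := - ln (M (x - rho ^+ n) (x + rho ^+ n)).
have rho_mono i j : (i <= j)%N -> rho ^+ j <= rho ^+ i.
  by move=> ij; rewrite ler_wiXn2l ?(ltW (rho_gt0 S)) ?(ltW (rho_lt1 S)).
have upper i n : (n <= size (f i))%N -> g n <= - ln (weight rho d p (f i)).
  move=> ni; rewrite lerN2.
  have le : weight rho d p (f i) <= M (x - rho ^+ n) (x + rho ^+ n).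
    apply: le_trans (weight_le_word_mass S _) _; apply: (mass_mono S) => z _.
    by have := x_in i; have := rho_mono _ _ ni; lra.
  by rewrite ler_ln ?posrE ?(weight_gt0 S) // (lt_le_trans (weight_gt0 S _) le).
(* Below the distances of the cylinder of [tau] to 0 and 1: a ball of radius
   [rho ^+ (size (f i) + q)] around [x] stays in the cylinder of [f i]. *)
have [q qP] : exists q, rho ^+ q < Num.min (y tau) (1 - (y tau + rho ^+ size tau)).
  have [|q qP] := @exp_small _ _ _ _ _ _ _ S (Num.min (y tau) (1 - (y tau + rho ^+ size tau))).
    by rewrite lt_min tau_gt0 subr_gt0.
  by exists q; exact: qP.
have {qP}[q1 q2] : rho ^+ q < y tau /\ rho ^+ q < 1 - (y tau + rho ^+ size tau).
  by move: qP; rewrite lt_min => /andP[].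
have lower i n : (size (f i) + q <= n)%N -> - ln C - ln (weight rho d p (f i)) <= g n.
  move=> ni; rewrite -opprD -lnM ?posrE ?(weight_gt0 S) // lerN2.
  have le : M (x - rho ^+ n) (x + rho ^+ n) <= C * weight rho d p (f i).
    apply: le_trans (gf i); apply: le_trans (word_mass_le_near S _); apply: (mass_mono S) => z _.
    have := rho_mono _ _ ni; rewrite exprD; have := xP i; have := exp_gt0 S (size (f i)).
    by move: q1 q2 => ? ? ? /andP[? ?] ? /andP[? ?]; apply/andP; split; nra.
  rewrite ler_ln ?posrE ?mulr_gt0 ?(weight_gt0 S) //.
  apply: lt_le_trans (weight_gt0 S (f n)) _.
  apply: le_trans (weight_le_word_mass S _) _; apply: (mass_mono S) => z _.
  have /rho_mono : (n <= size (f n))%N.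
    by elim: (n) => // k IH; apply: leq_ltn_trans IH (sz k).
  by have := x_in n; lra.
move=> e e0.
(* Passing from [n] to a neighbouring length of the sequence moves [t * n] by about [|t| * e1 * n];
   with this [e1] all errors together stay below [e * n]. *)
pose e1 := Num.min 1 (e / (4%:R * (1 + `|t|))).
have t0 := normr_ge0 t.
have e1_gt0 : 0 < e1 by rewrite lt_min ltr01 divr_gt0 // mulr_gt0 //; lra.
have e1_le1 : e1 <= 1 by rewrite ge_min lexx.
have e1_le : e1 * (4%:R * (1 + `|t|)) <= e.
  by rewrite -ler_pdivlMr ?ge_min ?lexx ?orbT // mulr_gt0 //; lra.
have [N NP] := fV e1 e1_gt0.
have [N' N'P] := natr_bound (2 / e * (`|ln C| + `|t| * q%:R)).
have tpos := ler_norm t; have := ler_norm (- t); rewrite normrN => tneg.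
have C1 := ler_norm (ln C).
exists (maxn (size (f N) + q) N') => n; rewrite geq_max => /andP[Nn N'n].
have fN0 i : (size (f (N + i)%N) < size (f (N + i).+1))%N by [].
have nN : N'%:R <= n%:R :> R by rewrite ler_nat.
have n0 : 0 <= n%:R :> R by [].
have const : `|ln C| + `|t| * q%:R <= e / 2 * n%:R.
  rewrite -invf_div -ler_pdivrMl ?invrK ?invf_div ?divr_gt0 //; exact: le_trans N'P nN.
have en : e1 * (4%:R * (1 + `|t|)) * n%:R <= e * n%:R by rewrite ler_wpM2r.
have qn : (q <= n)%N by rewrite (leq_trans _ Nn) // leq_addl.
have e1n : 0 <= e1 * n%:R by rewrite mulr_ge0 // ltW.
have tn := mulr_ge0 t0 e1n.
(* The last cylinder of level at most [n - q] contains the ball and bounds [g n] from below; the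
   first one of level above [n] lies in the ball and bounds [g n] from above. *)
rewrite -/(g n) ler_norml; apply/andP; split.
- have [||i /andP[i1 i2]] := index_between (f := fun i => size (f (N + i)%N)) (n := (n - q)%N).
    by move=> i; rewrite addnS.
    by rewrite addn0 leq_subRL // addnC.
  have /lower lo : (size (f (N + i)) + q <= n)%N.
    by rewrite addnC -leq_subRL.
  have [ba] := NP (N + i)%N (leq_addr _ _); rewrite ler_norml => /andP[V1 V2].
  have an : (size (f (N + i)%N))%:R <= n%:R :> R.
    by rewrite ler_nat (leq_trans i1) // leq_subr.
  have nb : n%:R <= (size (f (N + i).+1))%:R + q%:R :> R.
    by rewrite -natrD ler_nat addnC -leq_subLR -addnS ltnW.
  move: (size (f (N + i)%N))%:R (size (f (N + i).+1))%:R an nb ba V1 V2 lo => a b an nb ba V1 V2 lo.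
  have : e1 * a <= e1 * n%:R by rewrite ler_wpM2l // ltW.
  have := ler_wpM2r (_ : 0 <= n%:R - a) tpos; rewrite subr_ge0 => /(_ an).
  have : `|t| * (n%:R - a) <= `|t| * (e1 * n%:R + q%:R).
    by rewrite ler_wpM2l //; have := ler_wpM2l (ltW e1_gt0) an; lra.
  lra.
- have [||i /andP[i1 i2]] := index_between (f := fun i => size (f (N + i)%N)) (n := n).
    by move=> i; rewrite addnS.
    by rewrite addn0 (leq_trans _ Nn) // leq_addr.
  have /upper up : (n <= size (f (N + i.+1)))%N by exact: ltnW.
  have [ba _] := NP (N + i)%N (leq_addr _ _).
  have [_] := NP (N + i.+1)%N (leq_addr _ _); rewrite ler_norml => /andP[V1 V2].
  have an : (size (f (N + i)%N))%:R <= n%:R :> R by rewrite ler_nat.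
  have nb : n%:R <= (size (f (N + i.+1)%N))%:R :> R by rewrite ler_nat ltnW.
  rewrite -addnS in ba.
  move: (size (f (N + i)%N))%:R (size (f (N + i.+1)%N))%:R an nb ba V1 V2 up => a b an nb ba V1 V2 up.
  have h1 : e1 * a <= e1 * n%:R by rewrite ler_wpM2l // ltW.
  have h2 : e1 * b <= 2 * (e1 * n%:R).
    have : b <= 2 * n%:R by have := ler_wpM2r n0 e1_le1; lra.
    by move=> /(ler_wpM2l (ltW e1_gt0)); lra.
  have := ler_wpM2r (_ : 0 <= b - n%:R) tpos; rewrite subr_ge0 => /(_ nb).
  have : `|t| * (b - n%:R) <= `|t| * (e1 * n%:R) by rewrite ler_wpM2l //; lra.
  lra.
Qed.

End Rates.

(** * Net intervals and copies of them *)

Section SortedList.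
Context (R : realType).

Lemma zip_behead_mem (x0 : R) l : path <%R x0 l -> forall a b,
  ((a, b) \in zip (x0 :: l) l) <->
  [/\ a \in x0 :: l, b \in x0 :: l, a < b & forall z, z \in x0 :: l -> ~ (a < z < b)].
Proof.
elim: l x0 => [|x1 l IH] x0 /=.
  move=> _ a b; rewrite in_nil; split => // -[]; rewrite !inE => /eqP -> /eqP ->.
  by rewrite ltxx.
move=> /andP[x01 pl] a b.
have gt1 z : z \in l -> x1 < z by move/allP: (order_path_min lt_trans pl) => h /h.
rewrite inE; split.
- case/orP => [/eqP[-> ->]|/(IH _ pl)[al bl ab none]].
    rewrite !mem_head inE mem_head orbT; split => // z; rewrite !inE.
    by case/or3P => [/eqP->|/eqP->|/gt1]; move=> *; lra.
  rewrite inE al orbT inE bl orbT; split => // z; rewrite inE => /orP[/eqP ->|/none//].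
  by move: al; rewrite inE => /orP[/eqP ->|/gt1]; move=> *; lra.
- case; rewrite inE => /orP[/eqP ->|al] bl ab none.
    rewrite xpair_eqE eqxx /=; apply/orP; left.
    move: bl; rewrite inE => /orP[/eqP bx0|]; first by move: ab; rewrite bx0 ltxx.
    rewrite inE => /orP[//|/gt1 b1]; exfalso; apply: (none x1); first by rewrite inE mem_head orbT.
    by rewrite x01 b1.
  apply/orP; right; apply/(IH _ pl); split => //.
    move: bl; rewrite inE => /orP[/eqP bx0|//].
    move: al; rewrite inE => /orP[/eqP ax1|/gt1]; move=> *; exfalso; lra.
  by move=> z zl; apply: none; rewrite inE zl orbT.
Qed.

Lemma zip_behead_cover (x0 : R) l x : x0 <= x -> x < last x0 l ->
  exists D, D \in zip (x0 :: l) l /\ D.1 <= x < D.2.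
Proof.
elim: l x0 => [|x1 l IH] x0 /= x0x xl; first by exfalso; lra.
case: (ltP x x1) => xx1; first by exists (x0, x1); rewrite mem_head /= x0x xx1.
by have [D [Dl Dx]] := IH x1 xx1 xl; exists D; rewrite inE Dl orbT.
Qed.

End SortedList.

Section Cells.
Context (R : realType) (m : nat) (rho : R) (d p : 'I_m.+1 -> R).
Context (M : R -> R -> R) (T : seq R) (S : ifs_setting rho d p M T).

Local Notation y s := (Sword rho d s 0).
Local Notation p0 := (p ord0).

Definition endpt (n : nat) (z : R) : Prop :=
  exists (s : seq 'I_m.+1) (b : bool), size s = n /\ z = y s + rho ^+ n * b%:R.

Definition cell (n : nat) (D : R * R) : Prop :=
  [/\ endpt n D.1, endpt n D.2, D.1 < D.2 & forall z, endpt n z -> ~ (D.1 < z < D.2)].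

Lemma endpt_left s : endpt (size s) (y s).
Proof. by exists s, false; rewrite mulr0 addr0. Qed.

Lemma endpt_right s : endpt (size s) (y s + rho ^+ size s).
Proof. by exists s, true; rewrite mulr1. Qed.

Lemma endpt01 n z : endpt n z -> 0 <= z <= 1.
Proof.
move=> [s [b [<- ->]]]; have := y_ge0 S s; have := y_le S s; have := exp_gt0 S (size s).
by case: b => /=; lra.
Qed.

Lemma endptS n z : endpt n z -> endpt n.+1 z.
Proof.
(* The first map fixes 0 and the last one fixes 1, so the appended letter keeps the chosen end. *)
move=> [s [b [sn ->]]]; exists (s ++ [:: if b then ord_max else ord0]), b.
rewrite size_cat addn1 sn; split=> //; rewrite y_cat y_cons sn exprSr.
have -> : y ([::] : seq 'I_m.+1) = 0 by [].
by case: b; rewrite /= ?(d_first S) ?(d_last S); ring.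
Qed.

Lemma endpt_add n k z : endpt n z -> endpt (n + k) z.
Proof. by elim: k => [|k IH] nz; rewrite ?addn0 // addnS; apply: endptS; apply: IH. Qed.

(** Endpoints inside one cylinder of level [n] have rescaled positions [t + b] with [t] in [T], so
    their gaps take finitely many values. If the cylinder covering [z] does not contain [z'], its
    right end lies between the two and is used instead. *)
Lemma endpt_gap : exists2 e : R, 0 < e & forall n z z', endpt n z -> endpt n z' ->
  z < z' -> z + e * rho ^+ n <= z'.
Proof.
have [e e0 eP] := min_positive
  [seq t.1 + (t.2 : bool)%:R | t <- [seq (t, b) | t <- [seq t' - t | t' <- T, t <- T], b <- [:: true; false]]
     ++ [seq (t - 1, b) | t <- [seq t' - t | t' <- T, t <- T], b <- [:: true; false]]].
have in_cyl s n z : size s = n -> endpt n z -> y s <= z <= y s + rho ^+ n ->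
    exists t (b : bool), t \in T /\ z = y s + rho ^+ n * (t + b%:R).
  move=> sn [u [b [un ->]]] yz; exists (rho ^- n * (y u - y s)), b.
  split; last by rewrite mulrDr mulVKf ?(exp_neq0 S) //; ring.
  rewrite -un; apply: (offsets S); rewrite un ?sn //.
  by have := exp_gt0 S n; move: yz => /andP[]; rewrite ler_norml; case: b; rewrite ?mulr1 ?mulr0 => *; apply/andP; split; lra.
have same_cyl s n z z' : size s = n -> endpt n z -> endpt n z' -> y s <= z -> z < z' ->
    z' <= y s + rho ^+ n -> z + e * rho ^+ n <= z'.
  move=> sn zn zn' yz zz' zy'.
  have [|t [b [tT tE]]] := in_cyl s n z sn zn; first by rewrite yz /=; lra.
  have [|t' [b' [tT' tE']]] := in_cyl s n z' sn zn'; first by rewrite zy' andbT; lra.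
  have rn := exp_gt0 S n.
  suff : e <= t' - t + (b'%:R - b%:R) by rewrite tE tE'; nra.
  have dT : t' - t \in [seq t' - t | t' <- T, t <- T] by apply: allpairs_f.
  have pos : 0 < t' - t + (b'%:R - b%:R) by move: zz'; rewrite tE tE' ltrD2l ltr_pM2l //; lra.
  apply: eP pos; apply/mapP.
  case: b {tE}; last first.
    exists (t' - t, b'); last by rewrite /=; ring.
    rewrite mem_cat; apply/orP; left.
    by apply/allpairsPdep; exists (t' - t), b'; split => //; case: b' {tE'}; rewrite !inE.
  exists (t' - t - 1, b'); last by rewrite /= ; ring.
  rewrite mem_cat; apply/orP; right.
  by apply/allpairsPdep; exists (t' - t), b'; split => //; case: b' {tE'}; rewrite !inE.
exists e => // n z z' zn zn' zz'; have /andP[z0 _] := endpt01 zn; have /andP[_ z1'] := endpt01 zn'.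
have [|s [sn /andP[sz zs]]] := @cover_word _ _ _ _ _ _ _ S n z; first by rewrite z0 /=; lra.
case: (leP z' (y s + rho ^+ n)) => z's; first exact: (same_cyl s _ _ _ sn zn zn' sz zz' z's).
apply: le_trans (ltW z's); apply: (same_cyl s _ _ _ sn zn _ sz zs (lexx _)).
by rewrite -sn; apply: endpt_right.
Qed.

Lemma cell01 n D : cell n D -> 0 <= D.1 /\ D.2 <= 1.
Proof. by move=> [/endpt01 /andP[? ?] /endpt01 /andP[? ?] _ _]. Qed.

Lemma cell_word n D s : cell n D -> size s = n ->
  [\/ y s <= D.1 /\ D.2 <= y s + rho ^+ n, D.2 <= y s | y s + rho ^+ n <= D.1].
Proof.
move=> [_ _ D12 none] sn.
have := endpt_left s; have := endpt_right s; rewrite sn => /none nr /none nl.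
case: (leP D.2 (y s)) => h1; first by apply: Or32.
case: (leP (y s + rho ^+ n) D.1) => h2; first by apply: Or33.
apply: Or31; split; rewrite leNgt; apply/negP => h.
  by apply: nl; rewrite h h1.
by apply: nr; rewrite h h2.
Qed.

Lemma mem_net_points n z : reflect (endpt n z) (z \in net_points rho d n).
Proof.
rewrite /net_points mem_sort mem_undup mem_cat; apply: (iffP orP).
  case=> /codomP[s ->]; [exists (val s), false | exists (val s), true]; rewrite size_tuple.
    by rewrite mulr0 addr0.
  by split => //; rewrite Sword_affine size_tuple.
move=> [s [[] [sn ->]]]; [right|left]; apply/codomP; exists (Tuple (introT eqP sn)) => /=.
  by rewrite [RHS]Sword_affine sn.
by rewrite mulr0 addr0.
Qed.

Lemma net_points_sorted n : sorted <%R (net_points rho d n).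
Proof. by rewrite /net_points sort_lt_sorted undup_uniq. Qed.

Lemma mem_net n D : D \in net rho d n <-> cell n D.
Proof.
rewrite /net; have := net_points_sorted n.
have := @mem_net_points n; case: (net_points rho d n) => [|x0 l] memP /=.
  by split => // -[/memP].
case: D => a b /zip_behead_mem ->; split.
  by move=> [/memP ? /memP ? ? none]; split => // z /memP; exact: none.
by move=> [/memP ? /memP ? ? none]; split => // z /memP; exact: none.
Qed.

Lemma cell_exists n x : 0 <= x < 1 -> exists D, cell n D /\ D.1 <= x < D.2.
Proof.
move=> /andP[x0 x1].
suff [D [Dn Dx]] : exists D, D \in net rho d n /\ D.1 <= x < D.2 by exists D; split => //; apply/mem_net.
have e0 : endpt n 0.
  have := @endpt_add 0 n 0; rewrite add0n; apply; exists [::], false.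
  by rewrite /Sword /= mulr0 addr0.
have e1 : endpt n 1.
  have := @endpt_add 0 n 1; rewrite add0n; apply; exists [::], true.
  by rewrite /Sword /= expr0 mulr1 add0r.
rewrite /net; move: e0 e1 (net_points_sorted n) => /mem_net_points + /mem_net_points.
case: (net_points rho d n) => [//|h l] /= e0 e1 pl.
apply: zip_behead_cover.
  move: e0; rewrite inE => /orP[/eqP <- //|]; move/allP: (order_path_min lt_trans pl) => h0 /h0; lra.
apply: (lt_le_trans x1).
have : forall z, z \in h :: l -> z <= last h l.
  elim: l h pl {e0 e1} => [|h' l IH] h /=; first by move=> _ z; rewrite inE => /eqP ->.
  move=> /andP[hh' pl] z; rewrite inE => /orP[/eqP ->|/(IH _ pl)//].
  by apply: le_trans (ltW hh') _; apply: IH => //; rewrite mem_head.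
by apply.
Qed.

Lemma itv_sub_le (D E : R * R) : itv_sub D E = (E.1 <= D.1) && (D.2 <= E.2).
Proof. by rewrite /itv_sub subitvE !bnd_simp. Qed.

Lemma cell_overlap_eq n D E z : cell n D -> cell n E -> D.1 < z < D.2 -> E.1 < z < E.2 -> D = E.
Proof.
move=> [D1 D2 _ nD] [E1 E2 _ nE] /andP[zD1 zD2] /andP[zE1 zE2].
have le (a b : R) : ~ (a < b) -> b <= a by move=> h; rewrite leNgt; apply/negP.
rewrite [D]surjective_pairing [E]surjective_pairing; congr (_, _); apply/le_anti/andP; split;
  apply: le => h.
- by apply: (nE _ D1); rewrite h; lra.
- by apply: (nD _ E1); rewrite h; lra.
- by apply: (nD _ E2); rewrite h andbT; lra.
- by apply: (nE _ D2); rewrite h andbT; lra.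
Qed.

Lemma cell_sub n k D E z : cell n D -> cell (n + k) E -> D.1 <= z < D.2 -> E.1 <= z < E.2 ->
  D.1 <= E.1 /\ E.2 <= D.2.
Proof.
move=> [D1 D2 _ _] [_ _ _ nE] /andP[zD1 zD2] /andP[zE1 zE2].
split; rewrite leNgt; apply/negP => h.
  by apply: (nE _ (endpt_add k D1)); rewrite h; lra.
by apply: (nE _ (endpt_add k D2)); rewrite h; lra.
Qed.

Lemma parent_cell n D E : cell n.+1 D -> cell n E -> E.1 <= D.1 -> D.2 <= E.2 ->
  parent rho d n D = E.
Proof.
move=> cD cE ED1 ED2; rewrite /parent.
have D12 : D.1 < D.2 by case: cD.
have mid (F : R * R) : F.1 <= D.1 -> D.2 <= F.2 -> F.1 < (D.1 + D.2) / 2 < F.2.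
  by move=> *; apply/andP; split; lra.
have all_eq F : F \in [seq E0 <- net rho d n | itv_sub D E0] -> F = E.
  rewrite mem_filter itv_sub_le => /andP[/andP[h1 h2] /mem_net cF].
  exact: (cell_overlap_eq cF cE (mid _ h1 h2) (mid _ ED1 ED2)).
have : E \in [seq E0 <- net rho d n | itv_sub D E0].
  by rewrite mem_filter itv_sub_le ED1 ED2; apply/mem_net.
by case: [seq _ <- _ | _] all_eq => //= F l all_eq _; apply: all_eq; rewrite mem_head.
Qed.

End Cells.

(** * Net intervals of the same type: transport of children and masses *)

Section Similar.
Context (R : realType) (m : nat) (rho : R) (d p : 'I_m.+1 -> R).
Context (M : R -> R -> R) (T : seq R) (S : ifs_setting rho d p M T).

Local Notation y s := (Sword rho d s 0).
Local Notation p0 := (p ord0).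
Local Notation endpt := (endpt rho d).
Local Notation cell := (cell rho d).

(** The entries of [nbrs n D], as a predicate (see [mem_nbrs]). *)
Definition offset (n : nat) (D : R * R) (a : R) : Prop := exists s : seq 'I_m.+1,
  [/\ size s = n, D.1 = y s + rho ^+ n * a, y s <= D.1 & D.2 <= y s + rho ^+ n].

(* The first two components of the characteristic vectors agree; the position among siblings is
   irrelevant for [mu] and for the types of the children. *)
Definition same_type (n : nat) (D : R * R) (n' : nat) (D' : R * R) : Prop := exists l : R,
  [/\ D.2 = D.1 + rho ^+ n * l, D'.2 = D'.1 + rho ^+ n' * l &
      forall a, offset n D a <-> offset n' D' a].

Lemma same_type_sym n D n' D' : same_type n D n' D' -> same_type n' D' n D.
Proof. by move=> [l [? ? h]]; exists l; split => // a; rewrite h. Qed.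

Lemma same_type_trans n D n' D' n'' D'' :
  same_type n D n' D' -> same_type n' D' n'' D'' -> same_type n D n'' D''.
Proof.
move=> [l [D2 D'2 h]] [l' [E2 E'2 h']]; exists l; split => // [|a]; last by rewrite h h'.
suff -> : l = l' by [].
apply: (mulfI (exp_neq0 S n')); move: E2; rewrite D'2; exact: addrI.
Qed.

Lemma word_over_cell n D s z : cell n D -> size s = n ->
  D.1 < z < D.2 -> y s <= z <= y s + rho ^+ n -> y s <= D.1 /\ D.2 <= y s + rho ^+ n.
Proof.
move=> cD sn /andP[z1 z2] /andP[z3 z4].
case: (cell_word cD sn) => // h; suff : (0 : R) < 0 by rewrite ltxx.
  lra.
lra.
Qed.

Lemma rcons_word n (s : seq 'I_m.+1) : size s = n.+1 ->
  exists u j, [/\ size u = n, s = u ++ [:: j] & y s = y u + rho ^+ n * d j].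
Proof.
move: s; elim/last_ind => [//|u j _]; rewrite size_rcons => -[un].
exists u, j; rewrite cats1; split => //.
by rewrite -cats1 y_cat un y_cons (_ : y ([::] : seq 'I_m.+1) = 0) // mulr0 addr0.
Qed.

Lemma d_range j : 0 <= d j /\ d j + rho <= 1.
Proof. by split; [exact: (d_ge0 S) | have := d_le S j; lra]. Qed.

(** An endpoint of level [n.+1] interior to [D] comes from a word [u ++ [:: j]] where the cylinder
    of [u] covers all of [D]. Hence only the offset of [u] matters, and a word with this offset over
    [D'] reproduces the endpoint. [child_offset] rests on the same transport. *)
Lemma same_type_endpt n D n' D' l v : cell n D -> cell n' D' ->
  D.2 = D.1 + rho ^+ n * l -> D'.2 = D'.1 + rho ^+ n' * l ->
  (forall a, offset n D a -> offset n' D' a) -> 0 <= v <= l ->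
  endpt n.+1 (D.1 + rho ^+ n * v) -> endpt n'.+1 (D'.1 + rho ^+ n' * v).
Proof.
move=> cD cD' D2 D'2 off /andP[v0 vl] [s [b [sn sE]]].
have rn := exp_gt0 S n.
case: (ltgtP 0 v) v0 => // [v0 _|<- _]; last first.
  by rewrite mulr0 addr0; apply: (endptS S); case: cD'.
case: (ltgtP v l) vl => // [vl _|-> _]; last first.
  by rewrite -D'2; apply: (endptS S); case: cD'.
have [u [j [un su ysE]]] := rcons_word sn.
have [dj0 dj1] := d_range j; have r0 := rho_gt0 S.
have /andP[db0 db1] : 0 <= d j + rho * b%:R <= 1.
  by case: (b); rewrite ?mulr1 ?mulr0; apply/andP; split; lra.
have zE : D.1 + rho ^+ n * v = y u + rho ^+ n * (d j + rho * b%:R).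
  by rewrite sE ysE exprSr; ring.
have yu : y u <= D.1 + rho ^+ n * v <= y u + rho ^+ n.
  by rewrite zE lerDl mulr_ge0 ?(ltW rn) //= lerD2l ler_piMr ?(ltW rn).
have vD : D.1 < D.1 + rho ^+ n * v < D.2.
  by rewrite D2 ltrDl ltrD2l ltr_pM2l // vl andbT; exact: mulr_gt0.
have [yu1 yu2] := word_over_cell cD un vD yu.
have [|u' [u'n D'1 _ _]] := off (rho ^- n * (D.1 - y u)).
  by exists u; split => //; rewrite mulVKf ?(exp_neq0 S) //; ring.
have vE : rho ^- n * (D.1 - y u) + v = d j + rho * b%:R.
  apply: (mulfI (exp_neq0 S n)); rewrite mulrDr mulVKf ?(exp_neq0 S) //.
  have -> : rho ^+ n * v = y u + rho ^+ n * (d j + rho * b%:R) - D.1 by rewrite -zE; ring.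
  ring.
exists (u' ++ [:: j]), b; rewrite size_cat u'n addn1; split => //.
rewrite D'1 -addrA -mulrDr vE y_cat u'n y_cons (_ : y ([::] : seq 'I_m.+1) = 0) //.
by rewrite mulr0 exprSr; ring.
Qed.

Lemma child_offset n D n' D' l v w a : cell n D -> cell n' D' ->
  D.2 = D.1 + rho ^+ n * l -> D'.2 = D'.1 + rho ^+ n' * l ->
  (forall a, offset n D a -> offset n' D' a) -> 0 <= v -> v < w -> w <= l ->
  offset n.+1 (D.1 + rho ^+ n * v, D.1 + rho ^+ n * w) a ->
  offset n'.+1 (D'.1 + rho ^+ n' * v, D'.1 + rho ^+ n' * w) a.
Proof.
move=> cD cD' D2 D'2 off v0 vw wl [s [sn /= sE s1 s2]].
have rn := exp_gt0 S n; have rn' := exp_gt0 S n'.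
have [u [j [un su ysE]]] := rcons_word sn.
have [dj0 dj1] := d_range j; have r0 := rho_gt0 S.
have yu : y u <= D.1 + rho ^+ n * ((v + w) / 2) <= y u + rho ^+ n.
  by move: s1 s2; rewrite ysE exprSr => s1 s2; apply/andP; split; nra.
have vD : D.1 < D.1 + rho ^+ n * ((v + w) / 2) < D.2.
  by rewrite D2 ltrDl ltrD2l ltr_pM2l //; apply/andP; split; [apply: mulr_gt0 => // | ]; lra.
have [yu1 yu2] := word_over_cell cD un vD yu.
have [|u' [u'n D'1 _ _]] := off (rho ^- n * (D.1 - y u)).
  by exists u; split => //; rewrite mulVKf ?(exp_neq0 S) //; ring.
set c := rho ^- n * (D.1 - y u) in D'1.
have D1 : D.1 = y u + rho ^+ n * c by rewrite mulVKf ?(exp_neq0 S) //; ring.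
have cvE : c + v = d j + rho * a.
  apply: (mulfI (exp_neq0 S n)); move: sE; rewrite D1 ysE exprSr; move: (rho ^+ n) => q; lra.
have cw : d j <= c + v /\ c + w <= d j + rho.
  split; rewrite -(ler_pM2l rn); move: s1 s2; rewrite D1 ysE exprSr; move: (rho ^+ n) => q; lra.
have y_u'j : y (u' ++ [:: j]) = y u' + rho ^+ n' * d j.
  by rewrite y_cat u'n y_cons (_ : y ([::] : seq 'I_m.+1) = 0) // mulr0 addr0.
exists (u' ++ [:: j]); rewrite size_cat u'n addn1 /= y_u'j D'1 exprSr; split => //.
- by rewrite -addrA -mulrDr cvE; ring.
- by have := ler_wpM2l (ltW rn') cw.1; lra.
- by have := ler_wpM2l (ltW rn') cw.2; lra.
Qed.

Lemma same_type_child n D n' D' E : cell n D -> cell n' D' -> same_type n D n' D' ->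
  cell n.+1 E -> D.1 <= E.1 -> E.2 <= D.2 ->
  exists E', [/\ cell n'.+1 E', D'.1 <= E'.1, E'.2 <= D'.2 & same_type n.+1 E n'.+1 E'].
Proof.
move=> cD cD' [l [D2 D'2 off]] [E1 E2 E12 nE] DE1 DE2.
have rn := exp_gt0 S n; have rn' := exp_gt0 S n'.
pose v := rho ^- n * (E.1 - D.1); pose w := rho ^- n * (E.2 - D.1).
have E1v : E.1 = D.1 + rho ^+ n * v by rewrite mulVKf ?(exp_neq0 S) //; ring.
have E2w : E.2 = D.1 + rho ^+ n * w by rewrite mulVKf ?(exp_neq0 S) //; ring.
have v0 : 0 <= v by rewrite -(ler_pM2l rn) mulr0; lra.
have wl : w <= l by rewrite -(ler_pM2l rn); lra.
have vw : v < w by rewrite -(ltr_pM2l rn); lra.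
have off12 a : offset n D a -> offset n' D' a by move/off.
have off21 a : offset n' D' a -> offset n D a by move/off.
have EE : E = (D.1 + rho ^+ n * v, D.1 + rho ^+ n * w) by rewrite -E1v -E2w; case: (E).
exists (D'.1 + rho ^+ n' * v, D'.1 + rho ^+ n' * w); split => /=.
- split => /=.
  + by apply: (same_type_endpt cD cD' D2 D'2 off12); [apply/andP; split; lra | rewrite -E1v].
  + by apply: (same_type_endpt cD cD' D2 D'2 off12); [apply/andP; split; lra | rewrite -E2w].
  + by rewrite ltrD2l ltr_pM2l.
  + move=> z zn /andP[z1 z2].
    pose u := rho ^- n' * (z - D'.1).
    have zu : z = D'.1 + rho ^+ n' * u by rewrite mulVKf ?(exp_neq0 S) //; ring.
    move: zn z1 z2; rewrite zu !ltrD2l !ltr_pM2l // => zn vu uw.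
    apply: (nE (D.1 + rho ^+ n * u)); last by rewrite E1v E2w !ltrD2l !ltr_pM2l // vu.
    by apply: (same_type_endpt cD' cD D'2 D2 off21) zn; apply/andP; split; lra.
- by rewrite lerDl mulr_ge0 // ltW.
- by rewrite D'2 lerD2l ler_pM2l.
- exists (rho^-1 * (w - v)); rewrite EE /=; have r0 := rho_gt0 S; split.
  + by rewrite exprSr; field; rewrite lt0r_neq0.
  + by rewrite exprSr; field; rewrite lt0r_neq0.
  + by move=> a; split; [exact: (child_offset cD cD' D2 D'2 off12) |
                         exact: (child_offset cD' cD D'2 D2 off21)].
Qed.

(** In the expansion at level [n] only words covering [D] contribute, each the mass of an interval
    determined by its offset. A word over [D'] with the same offset contributes the same mass there,
    with weight at least [p0 ^+ n']. *)
Lemma same_type_mass n D n' D' l v w : cell n D -> cell n' D' ->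
  D.2 = D.1 + rho ^+ n * l -> D'.2 = D'.1 + rho ^+ n' * l ->
  (forall a, offset n D a -> offset n' D' a) -> 0 <= v -> w <= l ->
  M (D.1 + rho ^+ n * v) (D.1 + rho ^+ n * w) <=
  p0 ^- n' * M (D'.1 + rho ^+ n' * v) (D'.1 + rho ^+ n' * w).
Proof.
move=> cD cD' D2 D'2 off v0 wl.
rewrite (mass_iter S n) -[leRHS](wavg_const S n); apply: (wavg_mono S) => s sn.
have rn := exp_gt0 S n; have pn := p0X_gt0 S n'.
have rhs0 : 0 <= p0 ^- n' * M (D'.1 + rho ^+ n' * v) (D'.1 + rho ^+ n' * w).
  by rewrite mulr_ge0 ?(mass_ge0 S) // invr_ge0 ltW.
case: (pselect (y s <= D.1 /\ D.2 <= y s + rho ^+ n)) => [[h1 h2]|no].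
- have [|u [un D'1 _ _]] := off (rho ^- n * (D.1 - y s)).
    by exists s; split => //; rewrite mulVKf ?(exp_neq0 S) //; ring.
  rewrite [leRHS]mulrC ler_pdivlMr // [leLHS]mulrC D'1 -un -!addrA -!mulrDr.
  apply: le_trans (mass_word S u _ _); rewrite ler_pM2l ?(p0X_gt0 S) //.
  by rewrite le_eqVlt; apply/orP; left; apply/eqP; congr (M _ _); field; rewrite (exp_neq0 S).
- rewrite (mass_null S) // => z /andP[z0 z1]; rewrite (le_unscale S) (unscale_le S) => /andP[z2 z3].
  have rv := mulr_ge0 (ltW rn) v0; have rw := ler_wpM2l (ltW rn) wl.
  have rz := mulr_gt0 rn z0; have rz1 : rho ^+ n * z < rho ^+ n * 1 by rewrite ltr_pM2l.
  case: (cell_word cD sn) => [|h|h]; first exact: no.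
    by have : D.1 < D.1 by [lra]; rewrite ltxx.
  by have : D.1 < D.1 by [lra]; rewrite ltxx.
Qed.
End Similar.

(** * Copies of essential net intervals inside a rigid cylinder *)

Section EssentialCopy.
Context (R : realType) (m : nat) (rho : R) (d p : 'I_m.+1 -> R).
Context (M : R -> R -> R) (T : seq R) (S : ifs_setting rho d p M T).

Local Notation y s := (Sword rho d s 0).
Local Notation endpt := (endpt rho d).
Local Notation cell := (cell rho d).
Local Notation offset := (offset rho d).
Local Notation same_type := (same_type rho d).

Lemma mem_nbrs n D a : a \in nbrs rho d n D <-> offset n D a.
Proof.
rewrite /nbrs mem_sort mem_undup; split.
  case/mapP => s; rewrite mem_filter itv_sub_le => /andP[/andP[s1 s2] _] ->.
  exists (val s); rewrite size_tuple; split => //.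
    by rewrite mulVKf ?(exp_neq0 S) //; ring.
  by move: s2; rewrite /= Sword_affine size_tuple mulr1.
move=> [s [sn D1 s1 s2]]; apply/mapP; exists (Tuple (introT eqP sn)).
  have s2' : D.2 <= Sword rho d s 1 by rewrite Sword_affine sn mulr1.
  by rewrite mem_filter itv_sub_le mem_enum /= s1 s2'.
by rewrite /= D1 addrAC subrr add0r mulKf ?(exp_neq0 S).
Qed.

(** Level 0 is the only case to check: there [cvec] is prescribed, and it agrees with the general
    formulas. *)
Lemma cvec_fst n D : D \in net rho d n -> (cvec rho d n D).1 = (ell rho n D, nbrs rho d n D).
Proof.
case: n => // nD.
have /mem_net [e1 e2 D12 none] := nD.
have e01 z : endpt 0 z -> z = 0 \/ z = 1.
  move=> [s [b [/size0nil -> ->]]]; rewrite expr0 mul1r /Sword /= add0r.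
  by case: b; [right|left].
have D1 : D.1 = 0 by case: (e01 _ e1) => // h1; case: (e01 _ e2) => h2; lra.
have D2 : D.2 = 1 by case: (e01 _ e2) => // h; lra.
rewrite /= /ell D2 D1 expr0 invr1 mul1r subr0; congr (_, _).
have off a : offset 0 D a <-> a = 0.
  split=> [[s [/size0nil -> ]]|->].
    by rewrite /Sword /= expr0 D1 mul1r add0r.
  by exists [::]; rewrite /Sword /= expr0 D1 D2 mul1r !add0r lexx.
apply/esym/perm_small_eq => //; apply: uniq_perm => //; first by rewrite /nbrs sort_uniq undup_uniq.
by move=> a; rewrite inE; apply/idP/eqP => [/mem_nbrs /off //|/off /mem_nbrs].
Qed.

Lemma cvec_same_type n D n' D' : D \in net rho d n -> D' \in net rho d n' ->
  (cvec rho d n D).1 = (cvec rho d n' D').1 -> same_type n D n' D'.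
Proof.
move=> nD nD'; rewrite !cvec_fst // => -[eE nE].
exists (ell rho n D); split => [||a].
- by rewrite /ell mulVKf ?(exp_neq0 S) //; ring.
- by rewrite eE /ell mulVKf ?(exp_neq0 S) //; ring.
- by rewrite -!mem_nbrs nE.
Qed.

Lemma cell_parent n D : cell n.+1 D -> exists E, [/\ cell n E, E.1 <= D.1 & D.2 <= E.2].
Proof.
move=> cD; have [D0 D1] := cell01 S cD; have D12 : D.1 < D.2 by case: cD.
have [|E [cE Ez]] := cell_exists S n (x := D.1); first by rewrite D0 /=; lra.
exists E; split => //; first by case/andP: Ez.
case: cE Ez => [_ E2 _ _] /andP[_ Ez]; rewrite leNgt; apply/negP => h.
by case: cD => _ _ _ none; apply: (none _ (endptS S E2)); rewrite Ez h.
Qed.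

Context (tau : seq 'I_m.+1) (tau_rigid : rigid rho d tau).

Definition in_tau (D : R * R) : Prop := y tau <= D.1 /\ D.2 <= y tau + rho ^+ size tau.

(** Rigidity makes every endpoint and every covering word that matters for [D'] the image under
    [S_s] of one for [D]. *)
Lemma rigid_same_type s D : cell (size tau) D -> in_tau D ->
  let D' := (y s + rho ^+ size s * D.1, y s + rho ^+ size s * D.2) in
  cell (size s + size tau) D' /\ same_type (size tau) D (size s + size tau) D'.
Proof.
move=> [e1 e2 D12 none] [t1 t2] D'; have rs := exp_gt0 S (size s).
have rt := exp_gt0 S (size tau).
have push z : endpt (size tau) z -> endpt (size s + size tau) (y s + rho ^+ size s * z).
  move=> [u [b [un ->]]]; exists (s ++ u), b; rewrite size_cat un; split => //.
  by rewrite y_cat exprD; ring.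
(* Two kinds of contact are needed: an end of the cylinder of [u] may fall inside [D'], or this
   cylinder may cover [D']. *)
have pull u : size u = (size s + size tau)%N ->
    (exists2 z, D'.1 <= z <= D'.2 & y u < z < y u + rho ^+ (size s + size tau) \/
      D'.1 < z < D'.2 /\ y u <= z <= y u + rho ^+ (size s + size tau)) ->
    exists v, size v = size tau /\ y u = y (s ++ v).
  move=> un [z /andP[z1 z2] zu]; apply: tau_rigid => //.
  have := ler_wpM2l (ltW rs) t1; have := ler_wpM2l (ltW rs) t2.
  move: z1 z2 zu; rewrite /D' /= y_cat exprD ler_norml => z1 z2 zu ? ?.
  by case: zu => [/andP[? ?]|[/andP[? ?] /andP[? ?]]]; apply/andP; split; lra.
split.
  split; [exact: push | exact: push | by rewrite ltrD2l ltr_pM2l |].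
  move=> z [u [b [un zE]]] /= zD.
  have [|v [vn uE]] := pull u un.
    exists z; first by move: zD; rewrite /D' /=; lra.
    right; split => //; have := exp_gt0 S (size s + size tau).
    by rewrite zE; case: (b); rewrite ?mulr1 ?mulr0; lra.
  apply: (none (y v + rho ^+ size tau * b%:R)); first by exists v, b.
  move: zD; rewrite zE uE y_cat exprD -!addrA -mulrA -mulrDr !ltrD2l !ltr_pM2l //.
exists (rho ^- size tau * (D.2 - D.1)); split => [||a].
- by rewrite mulVKf ?(exp_neq0 S) //; ring.
- by rewrite /D' /= exprD; field; rewrite (exp_neq0 S).
split=> [[u [un D1 u1 u2]]|[u [un D1 u1 u2]]].
  exists (s ++ u); rewrite size_cat un /D' /= !y_cat exprD; split => //.
  - by rewrite D1; ring.
  - by rewrite lerD2l ler_pM2l.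
  - by rewrite -addrA -mulrDr lerD2l ler_pM2l.
have [|v [vn uE]] := pull u un.
  exists ((D'.1 + D'.2) / 2).
    have : D'.1 < D'.2 by rewrite ltrD2l ltr_pM2l.
    lra.
  have : D'.1 < D'.2 by rewrite ltrD2l ltr_pM2l.
  by move=> D'12; left; lra.
move: D1 u1 u2; rewrite uE /D' /= !y_cat exprD => D1 u1 u2.
exists v; split => //.
- apply: (mulfI (exp_neq0 S (size s))); move: D1; rewrite -!addrA => /addrI ->; ring.
- by move: u1; rewrite lerD2l ler_pM2l.
- by move: u2; rewrite -addrA -mulrDr lerD2l ler_pM2l.
Qed.

(** A net interval [D1] in the cylinder of [tau] has a copy [D2] of the same type inside [D N], by
    rigidity. Descending from [D N], the vector of [D2] lies in the essential class, so a path leads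
    from it back to the vector of [D N]. Replayed from [D1], this path descends inside the cylinder
    of [tau] and ends at a net interval of the type of [D N]. *)
Lemma essential_copy x : essential_point rho d x -> exists n D n' D',
  [/\ cell n D, D.1 <= x <= D.2, cell n' D', in_tau D' & same_type n D n' D'].
Proof.
move=> [Om [[loop closed] [g [[D [DP gE]] [N NP]]]]].
have [DN xD _] := DP N; move: xD; rewrite in_itv /= => xD.
have cDN : cell N (D N) by apply/mem_net.
have rt := exp_gt0 S (size tau).
exists N, (D N); suff : exists n E, [/\ cell n E, in_tau E & same_type N (D N) n E].
  by move=> [n [E [cE tE sE]]]; exists n, E.
(* Only the type recorded in [c] is tracked; the replayed path need not reproduce the positions
   among siblings. *)
pose realized (c : charvec R) := exists n E, [/\ cell n E, in_tau E &
  exists n' E', [/\ E' \in net rho d n', c.1 = (cvec rho d n' E').1 & same_type n' E' n E]].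
have step (a b : charvec R) : is_child rho d a b -> realized a -> realized b.
  move=> [k [F [nF aE bE]]] [n [E [cE tE [n' [E' [nE' aE' simE]]]]]].
  have cF : cell k.+1 F by apply/mem_net.
  have [P [cP PF1 PF2]] := cell_parent cF.
  have parE : parent rho d k F = P by exact: parent_cell PF1 PF2.
  have simPE : same_type k P n E.
    apply: (same_type_trans S _ simE). apply: cvec_same_type => //; first by apply/mem_net.
    by rewrite -aE' aE parE.
  have [E2 [cE2 E21 E22 simE2]] := same_type_child S cP cE simPE cF PF1 PF2.
  exists n.+1, E2; split => //.
    by case: tE => ? ?; split; [apply: le_trans E21 | apply: le_trans E22 _].
  by exists k.+1, F; rewrite bE.
have walk (l : seq (charvec R)) a : realized a -> path (fun a b => `[< is_child rho d a b >]) a l -> realized (last a l).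
  by elim: l a => //= b l IH a ra /andP[/asboolP ab pl]; apply: IH pl; apply: step ab ra.
have D1t : y tau < 1 by have := y_le S tau; lra.
have [|D1 [cD1 /andP[D11 D12]]] := cell_exists S (size tau) (x := y tau).
  by rewrite (y_ge0 S).
have tD1 : in_tau D1.
  have [_ _ _ none] := cD1; split; rewrite leNgt; apply/negP => h.
    by apply: (none _ (endpt_left rho d tau)); rewrite h.
  by apply: (none _ (endpt_right rho d tau)); rewrite h andbT; lra.
have DN12 : (D N).1 < (D N).2 by case: cDN.
have [DN0 DN1] := cell01 S cDN.
have [n0 n0P] := @exp_small _ _ _ _ _ _ _ S (((D N).2 - (D N).1) / 2) ltac:(lra).
have [|s [sn s1 s2]] := interval_word S (n := (N + n0)%N) DN0 DN1.
  by apply/ltW/n0P; rewrite leq_addl.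
have [cD2 simD2] := rigid_same_type s cD1 tD1.
set D2 := (_, _) in cD2 simD2.
have in_O k E : cell (N + k) E -> (D N).1 <= E.1 -> E.2 <= (D N).2 -> Om (cvec rho d (N + k) E).
  elim: k E => [|k IH] E cE E1 E2.
    have E12 : E.1 < E.2 by case: cE.
    rewrite addn0 in cE *; have -> : E = D N.
      by apply: (cell_overlap_eq cE cDN (z := (E.1 + E.2) / 2)); lra.
    by rewrite -gE; apply: NP.
  rewrite addnS in cE *; have [P [cP P1 P2]] := cell_parent cE.
  have E12 : E.1 < E.2 by case: cE.
  have [Q1 Q2] := cell_sub S cDN cP (z := E.1) ltac:(lra) ltac:(lra).
  apply: (closed _ _ (IH P cP Q1 Q2)); exists (N + k)%N, E; split => //; first by apply/mem_net.
  by rewrite (parent_cell cE cP P1 P2).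
have [_ sub conn] := loop.
have OD2 : Om (cvec rho d (size s + size tau) D2).
  rewrite sn -addnA; apply: in_O; rewrite ?addnA -?sn //.
    by apply: le_trans s1 _; rewrite /D2 /= lerDl mulr_ge0 ?(ltW (exp_gt0 S _)) // (cell01 S cD1).1.
  apply: le_trans s2; rewrite /D2 /= -sn lerD2l ler_piMr ?(ltW (exp_gt0 S _)) //.
  by case: (cell01 S cD1).
have ODN : Om (cvec rho d N (D N)) by rewrite -gE; apply: NP.
have [w [[_ pw] w2 _ aE lE]] := conn _ _ OD2 ODN.
case: w pw w2 aE lE => // a l /= pl _ aE lE.
have : realized (last a l).
  apply: walk pl; rewrite aE; exists (size tau), D1; split => //.
  exists (size s + size tau)%N, D2; split => //; first by apply/mem_net.
  exact: same_type_sym.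
rewrite lE => -[n [E [cE tE [n' [E' [nE' cEq simE]]]]]].
exists n, E; split => //; apply: (same_type_trans S _ simE).
exact: cvec_same_type.
Qed.

End EssentialCopy.

(** * Rates at essential points *)

Section NecessaryRates.
Context (R : realType) (m : nat) (rho : R) (d p : 'I_m.+1 -> R).
Context (M : R -> R -> R) (T : seq R) (S : ifs_setting rho d p M T).
Context (tau : seq 'I_m.+1).

Local Notation y s := (Sword rho d s 0).
Local Notation p0 := (p ord0).
Local Notation cost := (cost rho d M tau).

Lemma ball_mass_gt0 x n : 0 <= x <= 1 -> 0 < M (x - rho ^+ n) (x + rho ^+ n).
Proof.
move=> /andP[x0 x1]; have rn := exp_gt0 S n; have rn1 := exp_le1 S n.
have [k kP] := @exp_small _ _ _ _ _ _ _ S (rho ^+ n / 4) ltac:(lra).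
have [a [b [a0 b1 ab xa bx]]] : exists a b, [/\ 0 <= a, b <= 1, rho ^+ k <= (b - a) / 2,
    x - rho ^+ n <= a & b <= x + rho ^+ n].
  have := kP k (leqnn k) => rk; case: (leP x (1 / 2)) => xh.
    by exists x, (x + rho ^+ n / 2); split; lra.
  by exists (x - rho ^+ n / 2), x; split; lra.
have [s [sn ys sy]] := interval_word S a0 b1 ab.
apply: lt_le_trans (word_mass_gt0 S s) _; apply: (mass_mono S) => z _; rewrite sn; lra.
Qed.

Lemma decay_rate_ge x t s c C i0 : 0 <= x <= 1 -> decay_rate rho M x t -> 0 < C ->
  (forall i, (i0 <= i)%N -> M (x - rho ^+ (c + i)) (x + rho ^+ (c + i)) <= C * expR (- s) ^+ i) ->
  s <= t.
Proof.
move=> x01 xt C0 MP; rewrite leNgt; apply/negP => ts.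
have e0 : 0 < (s - t) / 2 by lra.
have [N NP] := xt _ e0; set e := (s - t) / 2 in e0 NP.
have [n nP] := natr_bound (e^-1 * ((t + e) * c%:R + ln C + 1)).
pose i := (maxn n (maxn N i0)).
have ni : (n <= i)%N by rewrite leq_maxl.
have Ni : (N <= c + i)%N.
  by rewrite (leq_trans _ (leq_addl _ _)) // (leq_trans _ (leq_maxr _ _)) // leq_maxl.
have i0i : (i0 <= i)%N by rewrite (leq_trans _ (leq_maxr _ _)) // leq_maxr.
have := NP _ Ni; rewrite ler_norml => /andP[_ up].
have := MP _ i0i; rewrite -ler_ln ?posrE ?ball_mass_gt0 ?mulr_gt0 ?exprn_gt0 ?expR_gt0 //.
rewrite lnM ?posrE ?exprn_gt0 ?expR_gt0 // lnXn ?expR_gt0 // expRK -mulr_natr => lo.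
have : e^-1 * ((t + e) * c%:R + ln C + 1) <= i%:R by rewrite (le_trans nP) // ler_nat.
rewrite ler_pdivrMl // => big.
by move: up; rewrite natrD; rewrite /e in big *; lra.
Qed.

(** Fixed shifts of the levels and a fixed loss [K] disappear in [e * i] for large [i]. *)
Lemma dear_rate_intro x t c c' K i0 : decay_rate rho M x t ->
  (forall i, (i0 <= i)%N -> exists u, size u = (c + i)%N /\
    - ln (M (x - rho ^+ (c' + i)) (x + rho ^+ (c' + i))) - K <= cost u) ->
  dear_rate rho d M tau t.
Proof.
move=> xt H e e0 n; have e2 : 0 < e / 2 by lra.
have [N NP] := xt _ e2.
have [k kP] := natr_bound ((e / 2)^-1 * ((t - e) * c%:R - (t - e / 2) * c'%:R + K)).
pose i := maxn n (maxn k (maxn N i0)).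
have ni : (n <= i)%N by rewrite leq_maxl.
have ki : (k <= i)%N by rewrite (leq_trans _ (leq_maxr _ _)) // leq_maxl.
have Ni : (N <= i)%N by rewrite (leq_trans _ (leq_maxr _ _)) // (leq_trans _ (leq_maxr _ _)) // leq_maxl.
have i0i : (i0 <= i)%N by rewrite (leq_trans _ (leq_maxr _ _)) // (leq_trans _ (leq_maxr _ _)) // leq_maxr.
have [u [un uc]] := H _ i0i; exists u; rewrite un; split; first by rewrite (leq_trans ni) ?leq_addl.
have /NP : (N <= c' + i)%N by rewrite (leq_trans Ni) ?leq_addl.
rewrite ler_norml => /andP[lo _].
have : (e / 2)^-1 * ((t - e) * c%:R - (t - e / 2) * c'%:R + K) <= i%:R.
  by rewrite (le_trans kP) // ler_nat.
rewrite ler_pdivrMl // => big.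
by apply: le_trans uc; move: lo; rewrite !natrD; lra.
Qed.

(** Half of the ball is enough: on one side of [x] there is room inside [D], even when [x] is an
    endpoint. The copy of that half lies in the cylinder of [tau] and contains a cylinder of some
    [tau ++ u], which is therefore not much heavier than the ball. *)
Lemma dear_rate_of_copy x t n D n' D' : cell rho d n D -> D.1 <= x <= D.2 ->
  cell rho d n' D' -> in_tau rho d tau D' -> same_type rho d n D n' D' ->
  decay_rate rho M x t -> dear_rate rho d M tau t.
Proof.
move=> cD /andP[xD1 xD2] cD' [tD1 tD2] [l [D2 D'2 off]] xt.
have rn := exp_gt0 S n; have rn' := exp_gt0 S n'; have rt := exp_gt0 S (size tau).
have D12 : D.1 < D.2 by case: cD.
pose v0 := rho ^- n * (x - D.1).
have xv : x = D.1 + rho ^+ n * v0 by rewrite mulVKf ?(exp_neq0 S) //; ring.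
have v00 : 0 <= v0 by rewrite -(ler_pM2l rn) mulr0; lra.
have v0l : v0 <= l by rewrite -(ler_pM2l rn); lra.
have l0 : 0 < l by rewrite -(ltr_pM2l rn) mulr0; lra.
(* Beyond [i0] a piece of relative length [rho ^+ i] fits into [D] on one side of [x]; [c0] pays for
   the halving in [interval_word]. *)
have [i0 i0P] := @exp_small _ _ _ _ _ _ _ S (l / 2) ltac:(lra).
have [c0 c0P] := @exp_small _ _ _ _ _ _ _ S (1 / 2) ltac:(lra).
apply: (dear_rate_intro (c := (n' + c0)%N) (c' := n) (K := - ln (p0 ^+ n)) (i0 := i0) xt) => i i0i.
have ri := exp_gt0 S i; have := i0P _ i0i => ril.
have [v [w [v1 wl vw vx xw]]] : exists v w, [/\ 0 <= v, w <= l, w = v + rho ^+ i,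
    v0 - rho ^+ i <= v & w <= v0 + rho ^+ i].
  case: (leP v0 (l / 2)) => h; first by exists v0, (v0 + rho ^+ i); split => //; lra.
  by exists (v0 - rho ^+ i), v0; split => //; lra.
have Mle : M (D'.1 + rho ^+ n' * v) (D'.1 + rho ^+ n' * w) <=
    p0 ^- n * M (x - rho ^+ (n + i)) (x + rho ^+ (n + i)).
  apply: le_trans (same_type_mass S cD' cD D'2 D2 (fun a => (off a).2) v1 wl) _.
  rewrite ler_pM2l ?invr_gt0 ?(p0X_gt0 S) //; apply: (mass_mono S) => z _.
  have := ler_wpM2l (ltW rn) vx; have := ler_wpM2l (ltW rn) xw.
  by rewrite xv exprD => *; lra.
pose a := rho ^- size tau * (D'.1 + rho ^+ n' * v - y tau).
pose b := rho ^- size tau * (D'.1 + rho ^+ n' * w - y tau).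
have aE : y tau + rho ^+ size tau * a = D'.1 + rho ^+ n' * v.
  by rewrite mulVKf ?(exp_neq0 S) //; ring.
have bE : y tau + rho ^+ size tau * b = D'.1 + rho ^+ n' * w.
  by rewrite mulVKf ?(exp_neq0 S) //; ring.
have a0 : 0 <= a.
  have := mulr_ge0 (ltW rn') v1 => h; rewrite -(ler_pM2l rt) mulr0; lra.
have b1 : b <= 1.
  have := ler_wpM2l (ltW rn') wl => h; rewrite -(ler_pM2l rt) mulr1; lra.
have ab : rho ^+ (n' + c0 + i) <= (b - a) / 2.
  have h : rho ^+ size tau * (b - a) = rho ^+ n' * rho ^+ i.
    by rewrite mulrBr; move: aE bE; rewrite vw; lra.
  have h2 : b - a >= rho ^+ n' * rho ^+ i.
    have : 0 <= b - a by rewrite -(ler_pM2l rt) mulr0 h mulr_ge0 // ltW.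
    by move=> ba; rewrite -h ler_piMl // (exp_le1 S).
  have := c0P c0 (leqnn _) => hc; rewrite !exprD.
  have := mulr_gt0 rn' ri; nra.
have [u [un ua ub]] := interval_word S a0 b1 ab.
exists u; split => //.
have wm_gt0 := word_mass_gt0 S (tau ++ u).
have le : p0 ^+ n * word_mass rho d M (tau ++ u) <= M (x - rho ^+ (n + i)) (x + rho ^+ (n + i)).
  rewrite mulrC -ler_pdivlMr ?(p0X_gt0 S) // mulrC; apply: le_trans Mle.
  apply: (mass_mono S) => z _; rewrite -aE -bE y_cat size_cat exprD un.
  have := ler_wpM2l (ltW rt) ua; have := ler_wpM2l (ltW rt) ub => h1 h2 /andP[h3 h4].
  by apply/andP; split; lra.
have pn := p0X_gt0 S n.
have : ln (p0 ^+ n * word_mass rho d M (tau ++ u)) <= ln (M (x - rho ^+ (n + i)) (x + rho ^+ (n + i))).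
  by rewrite ler_ln ?posrE ?(lt_le_trans _ le) ?mulr_gt0.
by rewrite lnM ?posrE // /cost; lra.
Qed.

(* [cost u >= s * size u] for all long [u]. *)
Definition overpriced (s : R) (n0 : nat) : Prop := forall u, (n0 <= size u)%N ->
  word_mass rho d M (tau ++ u) <= expR (- s) ^+ size u.

Lemma not_cheap_rate t : ~ cheap_rate rho d M tau t ->
  exists e n0, [/\ 0 < e, overpriced (t + e) n0 & p0 <= expR (- (t + e))].
Proof.
move=> nct; have [e [n0 [e0 H]]] : exists e n0, 0 < e /\
    forall u, (n0 <= size u)%N -> (t + e) * (size u)%:R < cost u.
  apply: contrapT => no; apply: nct => e e0 n; apply: contrapT => no2; apply: no.
  exists e, n; split => // u nu; rewrite ltNge; apply/negP => h; apply: no2.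
  by exists u.
exists e, n0; split => // [u /H h|].
  rewrite -ler_ln ?posrE ?exprn_gt0 ?expR_gt0 ?(word_mass_gt0 S) //.
  by rewrite lnXn ?expR_gt0 // expRK -mulr_natr; move: h; rewrite /cost; lra.
(* Words cost at most [- ln p0] per letter up to the prefix [tau]; a rate [t + e] above this would
   be refuted by one long word. *)
rewrite -[leLHS]lnK ?posrE ?(p_gt0 S) // ler_expR lerNr leNgt; apply/negP => h.
have e1 : 0 < t + e + ln p0 by lra.
have [n nP] := natr_bound ((t + e + ln p0)^-1 * (- ln p0 * (size tau)%:R)).
have /H : (n0 <= size (nseq (maxn n n0) (ord0 : 'I_m.+1)))%N by rewrite size_nseq leq_maxr.
have := cost_le S tau (nseq (maxn n n0) ord0); rewrite size_nseq natrD => h1 h2.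
have : (t + e + ln p0)^-1 * (- ln p0 * (size tau)%:R) <= (maxn n n0)%:R.
  by rewrite (le_trans nP) // ler_nat leq_maxl.
rewrite ler_pdivrMl // => h3; lra.
Qed.

(** An interval shorter than the endpoint gap of level [i] is covered by two cylinders: one covering
    its left end and, if needed, one covering the right end of the first, which reaches at least a
    gap further. This gives the factor 2. *)
Lemma overpriced_interval s n0 : overpriced s n0 -> exists c, forall i a b,
  (n0 <= i)%N -> 0 <= a -> a < b -> b <= 1 -> b - a <= rho ^+ (c + i) ->
  M (y tau + rho ^+ size tau * a) (y tau + rho ^+ size tau * b) <= 2 * expR (- s) ^+ i.
Proof.
move=> ov; have [e e0 eP] := endpt_gap S.
have [c cP] := exp_small S e0; exists c => i a b ni a0 ab b1 bac.
have rt := exp_gt0 S (size tau); have ri := exp_gt0 S i.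
have q0 : 0 < expR (- s) ^+ i by rewrite exprn_gt0 ?expR_gt0.
have bae : b - a < e * rho ^+ i.
  by apply: le_lt_trans bac _; rewrite exprD ltr_pM2r // cP.
have one u a' b' : size u = i -> y u <= a' -> b' <= y u + rho ^+ i ->
    M (y tau + rho ^+ size tau * a') (y tau + rho ^+ size tau * b') <= expR (- s) ^+ i.
  move=> ui ua ub; have := ov u; rewrite ui => /(_ ni); apply: le_trans.
  apply: (mass_mono S) => z _; rewrite y_cat size_cat exprD ui.
  have := ler_wpM2l (ltW rt) ua; have := ler_wpM2l (ltW rt) ub => h1 h2 /andP[h3 h4].
  by apply/andP; split; lra.
have [|u [un /andP[ua au]]] := @cover_word _ _ _ _ _ _ _ S i a.
  by apply/andP; split; lra.
case: (leP b (y u + rho ^+ i)) => ub.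
  by have := one u a b un ua ub; lra.
have [|v [vn /andP[va av]]] := @cover_word _ _ _ _ _ _ _ S i (y u + rho ^+ i).
  by have := y_ge0 S u; move=> ?; apply/andP; split; lra.
have ev : y u + rho ^+ i + e * rho ^+ i <= y v + rho ^+ i.
  apply: eP => //; first by rewrite -un; apply: endpt_right.
  by rewrite -vn; apply: endpt_right.
apply: le_trans (mass_split S _ (y tau + rho ^+ size tau * (y u + rho ^+ i)) _) _.
have := one u a (y u + rho ^+ i) un ua (lexx _).
have := one v (y u + rho ^+ i) b vn va ltac:(lra).
lra.
Qed.

(** The bound is confined to subintervals of [D], since the copy tells nothing beyond the ends of
    [D]. *)
Lemma overpriced_copy s n0 n D n' D' : overpriced s n0 -> cell rho d n D ->
  cell rho d n' D' -> in_tau rho d tau D' -> same_type rho d n D n' D' ->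
  exists c C, 0 < C /\ forall i a b, (n0 <= i)%N -> D.1 <= a -> a < b -> b <= D.2 ->
    b - a <= rho ^+ (c + i) -> M a b <= C * expR (- s) ^+ i.
Proof.
move=> ov cD cD' [tD1 tD2] [l [D2 D'2 off]].
have [c cP] := overpriced_interval ov.
have rn := exp_gt0 S n; have rn' := exp_gt0 S n'; have rt := exp_gt0 S (size tau).
exists (size tau + n + c)%N, (p0 ^- n' * 2); split.
  by rewrite mulr_gt0 // invr_gt0 (p0X_gt0 S).
move=> i a b ni Da ab bD ba.
pose v := rho ^- n * (a - D.1); pose w := rho ^- n * (b - D.1).
have av : a = D.1 + rho ^+ n * v by rewrite mulVKf ?(exp_neq0 S) //; ring.
have bw : b = D.1 + rho ^+ n * w by rewrite mulVKf ?(exp_neq0 S) //; ring.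
have v0 : 0 <= v by rewrite -(ler_pM2l rn) mulr0; lra.
have wl : w <= l by rewrite -(ler_pM2l rn); lra.
have vw : v < w by rewrite -(ltr_pM2l rn); lra.
rewrite {1}av {1}bw; apply: le_trans (same_type_mass S cD cD' D2 D'2 (fun a => (off a).1) v0 wl) _.
rewrite -mulrA ler_pM2l ?invr_gt0 ?(p0X_gt0 S) //.
pose a' := rho ^- size tau * (D'.1 + rho ^+ n' * v - y tau).
pose b' := rho ^- size tau * (D'.1 + rho ^+ n' * w - y tau).
have aE : y tau + rho ^+ size tau * a' = D'.1 + rho ^+ n' * v.
  by rewrite mulVKf ?(exp_neq0 S) //; ring.
have bE : y tau + rho ^+ size tau * b' = D'.1 + rho ^+ n' * w.
  by rewrite mulVKf ?(exp_neq0 S) //; ring.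
have := mulr_ge0 (ltW rn') v0; have := ler_wpM2l (ltW rn') wl => h1 h2.
have := vw; rewrite -(ltr_pM2l rn') => h3.
rewrite -aE -bE; apply: cP => //.
- by rewrite -(ler_pM2l rt) mulr0; lra.
- by rewrite -(ltr_pM2l rt); lra.
- by rewrite -(ler_pM2l rt) mulr1; lra.
- have h4 : rho ^+ size tau * (b' - a') = rho ^+ n' * (w - v) by rewrite !mulrBr; lra.
  have h5 : rho ^+ n * (w - v) = b - a by rewrite av bw; ring.
  have h6 : w - v <= rho ^+ size tau * rho ^+ (c + i).
    rewrite -(ler_pM2l rn) h5; apply: le_trans ba _.
    by rewrite -addnA -addnA !exprD le_eqVlt; apply/orP; left; apply/eqP; ring.
  rewrite -(ler_pM2l rt) h4; apply: le_trans h6.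
  by rewrite ler_piMl ?(exp_le1 S) // subr_ge0 ltW.
Qed.

Lemma d_inj i j : d i = d j -> i = j.
Proof.
move=> dij; apply: val_inj; case: (ltngtP i j) => // /(d_incr S); by rewrite dij ltxx.
Qed.

(* [x] is an endpoint at all levels from [n] on and only one side of it is controlled. The cylinders
   that touch [x] from the other side lose a factor [p0] per level, while those
   containing [x] in their interior are seen from the controlled side. *)
Lemma one_sided_ball x (right : bool) n s s' c C i0 : endpt rho d n x -> 0 < C -> s' < s ->
  p0 <= expR (- s) ->
  (forall i, (i0 <= i)%N -> (if right then M x (x + rho ^+ (c + i)) else M (x - rho ^+ (c + i)) x)
     <= C * expR (- s) ^+ i) ->
  exists c' C' i0', 0 < C' /\ forall i, (i0' <= i)%N ->
    M (x - rho ^+ (c' + i)) (x + rho ^+ (c' + i)) <= C' * expR (- s') ^+ i.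
Proof.
move=> xn C0 ss' pq side.
set q := expR (- s) in pq side; set q' := expR (- s').
have q0 : 0 < q by apply: expR_gt0.
have qq' : q < q' by rewrite ltr_expR ltrN2.
have q'0 : 0 < q' by apply: expR_gt0.
(* Words whose cylinder contains [x], by position: [common] has [x] in the interior, [bad] ends at
   [x] from the uncontrolled side, [touch] from the controlled one. *)
pose common k := wavg p k (fun u => (y u < x < y u + rho ^+ k)%R%:R).
pose bad k := wavg p k (fun u => (y u + rho ^+ k * right%:R == x)%R%:R).
pose touch k := wavg p k (fun u => (y u + rho ^+ k * (~~ right)%:R == x)%R%:R).
(* A bad word extends either a word with [x] in its interior or a shorter bad word, the latter only
   by the extreme letter [jb], of weight [p0]. *)
have bad_step k : bad k.+1 <= p0 * bad k + common k.
  rewrite /bad -addn1 wavg_cat -(wavgZ p) -(wavgD p); apply: (wavg_mono S) => u un.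
  pose jb : 'I_m.+1 := if right then ord_max else ord0.
  have pjb : p jb = p0 by rewrite /jb; case: (right); rewrite // (p_last S).
  have yj j : y (u ++ [:: j]) = y u + rho ^+ k * d j.
    by rewrite y_cat y_cons un (_ : y ([::] : seq 'I_m.+1) = 0) // mulr0 addr0.
  have rk := exp_gt0 S k; have r0 := rho_gt0 S; have r1 := rho_lt1 S.
  case: (boolP (y u < x < y u + rho ^+ k)) => cmn.
    rewrite [leRHS]addrC -[leLHS]addr0; apply: lerD; last first.
      by apply: mulr_ge0; [rewrite ltW ?(p_gt0 S) | exact: ler0n].
    rewrite -[leRHS](wavg_const S 1); apply: (wavg_mono S) => w _.
    by rewrite ler_nat leq_b1.
  rewrite addr0.
  have onlyjb j : y (u ++ [:: j]) + rho ^+ (k + 1) * right%:R == x ->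
      j = jb /\ y u + rho ^+ k * right%:R = x.
    rewrite yj exprD expr1 => /eqP xE; move: cmn; rewrite -xE /jb.
    case: (right); rewrite ?mulr1 ?mulr0 ?addr0 negb_and -!leNgt => /orP[h|h].
    - exfalso; have := mulr_gt0 rk r0; have := mulr_ge0 (ltW rk) (d_ge0 S j); lra.
    - have dE : d j = d ord_max.
        rewrite (d_last S); have := d_le S j => dl.
        have : 1 <= d j + rho by rewrite -(ler_pM2l rk); lra.
        lra.
      by rewrite (d_inj dE) (d_last S); split => //; ring.
    - have dE : d j = d ord0.
        rewrite (d_first S); have := d_ge0 S j => dl.
        have : d j <= 0 by rewrite -(ler_pM2l rk); lra.
        lra.
      by rewrite (d_inj dE) (d_first S); split => //; ring.
    - exfalso; have := d_le S j => dl.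
      have : rho ^+ k * d j < rho ^+ k * 1 by rewrite ltr_pM2l //; lra.
      lra.
  rewrite /= (bigD1 jb) //= pjb big1 ?addr0.
    rewrite ler_pM2l ?(p_gt0 S) //; case: eqP => // /eqP /onlyjb [_ ->].
    by rewrite eqxx.
  move=> j jjb; case: eqP => [/eqP /onlyjb[jE _]|]; last by rewrite mulr0.
  by rewrite jE eqxx in jjb.
(* With [c3] the radius [rho ^+ (c3 + c + k)] is below the gap of endpoints of level [k], so the
   ball meets only cylinders containing [x]. With [c4], each word counted in [common] or [touch]
   puts relative mass at least [p0 ^+ c4] on the controlled half of the ball. *)
have [e e0 eP] := endpt_gap S.
have [c3 c3P] := exp_small S e0.
have [c4 c4P] := @exp_small _ _ _ _ _ _ _ S (rho ^+ (c3 + c) / 2) ltac:(by have := exp_gt0 S (c3 + c); lra).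
have e3 : rho ^+ (c3 + c) < e by apply: c3P; rewrite leq_addr.
have r3 := exp_gt0 S (c3 + c); have pc4 := p0X_gt0 S c4.
have xk k : (n <= k)%N -> endpt rho d k x by move=> nk; have := endpt_add S (k - n) xn; rewrite subnKC.
have gap k u : (n <= k)%N -> size u = k ->
    [/\ y u < x -> y u + e * rho ^+ k <= x, x < y u -> x + e * rho ^+ k <= y u,
        y u + rho ^+ k < x -> y u + rho ^+ k + e * rho ^+ k <= x &
        x < y u + rho ^+ k -> x + e * rho ^+ k <= y u + rho ^+ k].
  move=> nk uk; have xk' := xk _ nk.
  have yk : endpt rho d k (y u) by rewrite -uk; apply: endpt_left.
  have yk' : endpt rho d k (y u + rho ^+ k) by rewrite -uk; apply: endpt_right.
  by split; apply: eP.
pose sd k := if right then M x (x + rho ^+ (c3 + c + k)) else M (x - rho ^+ (c3 + c + k)) x.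
have word_ge a b : 0 <= a -> b <= 1 -> b = a + rho ^+ (c3 + c) -> p0 ^+ c4 <= M a b.
  move=> a0 b1 ba; have := c4P c4 (leqnn _) => h4.
  have [|u [un ua ub]] := interval_word S (n := c4) a0 b1; first by lra.
  rewrite -un; apply: le_trans (weight_ge S u) _; apply: le_trans (weight_le_word_mass S u) _.
  by apply: (mass_mono S) => z _; rewrite un; lra.
have near_e k : rho ^+ (c3 + c + k) < e * rho ^+ k.
  by rewrite exprD ltr_pM2r // (exp_gt0 S).
have seen k : (n <= k)%N -> p0 ^+ c4 * (common k + touch k) <= sd k.
  move=> nk; rewrite /common /touch /sd -(wavgD p) -(wavgZ p).
  have rk := exp_gt0 S k; have nek := near_e k.
  have kE : rho ^+ (c3 + c + k) = rho ^+ k * rho ^+ (c3 + c) by rewrite exprD mulrC.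
  case: (right); rewrite (mass_iter S k); apply: (wavg_mono S) => u uk /=;
    have [g1 _ _ g4] := gap k u nk uk; rewrite ?mulr0 ?mulr1 ?addr0.
  - have main : y u <= x -> x < y u + rho ^+ k -> p0 ^+ c4 <=
        M (rho ^- k * (x - y u)) (rho ^- k * (x + rho ^+ (c3 + c + k) - y u)).
      move=> h1 /g4 h2; apply: word_ge.
      + by rewrite (unscale_le S) mulr0 addr0.
      + by rewrite (le_unscale S) mulr1; lra.
      + by rewrite kE; field; rewrite (exp_neq0 S).
    case: (boolP (y u < x < y u + rho ^+ k)) => [/andP[h1 h2]|_].
      rewrite (lt_eqF h1) addr0 mulr1; apply: main => //; exact: ltW.
    rewrite add0r; case: eqP => [yx|_]; last by rewrite mulr0 (mass_ge0 S).
    by rewrite mulr1; apply: main; rewrite ?yx // ltrDl.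
  - have main : y u < x -> x <= y u + rho ^+ k -> p0 ^+ c4 <=
        M (rho ^- k * (x - rho ^+ (c3 + c + k) - y u)) (rho ^- k * (x - y u)).
      move=> /g1 h1 h2; apply: word_ge.
      + by rewrite (unscale_le S) mulr0 addr0; lra.
      + by rewrite (le_unscale S) mulr1.
      + by rewrite kE; field; rewrite (exp_neq0 S).
    case: (boolP (y u < x < y u + rho ^+ k)) => [/andP[h1 h2]|_].
      rewrite (gt_eqF h2) addr0 mulr1; apply: main => //; exact: ltW.
    rewrite add0r; case: eqP => [yx|_]; last by rewrite mulr0 (mass_ge0 S).
    by rewrite mulr1; apply: main; rewrite -?yx // ltrDl.
have seen_le k : (n + i0 <= k)%N -> common k + touch k <= (C * q ^+ c3 / p0 ^+ c4) * q ^+ k.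
  move=> nk; rewrite mulrAC ler_pdivlMr // mulrC.
  apply: le_trans (seen k (leq_trans (leq_addr _ _) nk)) _.
  rewrite -mulrA -exprD /sd -addnA (addnCA c3); apply: side.
  by rewrite (leq_trans (leq_addl n _)) // (leq_trans nk) // leq_addl.
have ball k : (n <= k)%N -> M (x - rho ^+ (c3 + c + k)) (x + rho ^+ (c3 + c + k)) <= bad k + (common k + touch k).
  move=> nk; rewrite /bad /common /touch -!(wavgD p) (mass_iter S k); apply: (wavg_mono S) => u uk.
  have [_ g2 g3 _] := gap k u nk uk; have nek := near_e k; have rk := exp_gt0 S k.
  case: (boolP (y u <= x <= y u + rho ^+ k)) => [/andP[h1 h2]|out].
    apply: le_trans (mass_le1 S _ _) _; rewrite -!natrD ler1n.
    case: (ltgtP (y u) x) h1 => // [h1 _|yx _].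
      case: (ltgtP x (y u + rho ^+ k)) h2 => // [h2 _|xy _]; first by rewrite addnCA add1n.
      by case: (right); rewrite /= mulr1 -xy eqxx !addn_gt0 /= ?orbT.
    by case: (right); rewrite /= mulr0 addr0 yx eqxx !addn_gt0 /= ?orbT.
  rewrite (mass_null S) => [|z /andP[z0 z1]]; first by rewrite -!natrD ler0n.
  rewrite (le_unscale S) (unscale_le S) => /andP[h1 h2].
  have rz0 := mulr_gt0 rk z0; have rz1 : rho ^+ k * z < rho ^+ k * 1 by rewrite ltr_pM2l.
  move: out; rewrite negb_and -!ltNge => /orP[/g2|/g3] h3.
    by have : x < x by [lra]; rewrite ltxx.
  by have : x < x by [lra]; rewrite ltxx.
set C1 := C * q ^+ c3 / p0 ^+ c4 in seen_le.
have C1_gt0 : 0 < C1 by rewrite divr_gt0 // mulr_gt0 // exprn_gt0.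
have touch_ge0 k : 0 <= touch k by apply: (wavg_ge0 S) => u _; exact: ler0n.
pose n1 := (n + i0)%N.
(* The first term closes the induction step of [bad_le], the second its start. The recursion
   [p0 * bad k + C1 * q ^+ k] can be resonant when [p0 = q], which is why the rate is lowered from
   [s] to [s']. *)
pose C2 := C1 / (q' - q) + bad n1 / q' ^+ n1.
have bad_ge0 k : 0 <= bad k by apply: (wavg_ge0 S) => u _; exact: ler0n.
have C2_ge : C1 <= C2 * (q' - q).
  rewrite mulrDl divfK ?lt0r_neq0 ?subr_gt0 // lerDl mulr_ge0 //.
    by rewrite divr_ge0 // exprn_ge0 // ltW.
  by rewrite subr_ge0 ltW.
have C2_ge0 : 0 <= C2.
  by rewrite addr_ge0 // divr_ge0 ?exprn_ge0 ?subr_ge0 // ltW.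
have qk k : q ^+ k <= q' ^+ k by rewrite lerXn2r ?nnegrE ?ltW.
have bad_le k : bad (n1 + k)%N <= C2 * q' ^+ (n1 + k).
  elim: k => [|k IH].
    rewrite addn0 mulrDl divfK ?lt0r_neq0 ?exprn_gt0 // lerDr mulr_ge0 ?exprn_ge0 ?ltW //.
    by rewrite divr_gt0 // subr_gt0.
  rewrite addnS; apply: le_trans (bad_step _) _; rewrite exprS.
  have := seen_le _ (leq_addr k n1); have := touch_ge0 (n1 + k)%N.
  have := ler_wpM2l (ltW C1_gt0) (qk (n1 + k)%N).
  have := ler_wpM2l (ltW (p_gt0 S ord0)) IH.
  have Q0 : 0 < q' ^+ (n1 + k) by rewrite exprn_gt0.
  have := ler_wpM2r (ltW Q0) C2_ge; have := ler_wpM2r (mulr_ge0 C2_ge0 (ltW Q0)) pq.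
  lra.
exists (c3 + c)%N, (C2 + C1), n1; split; first by rewrite ltr_wpDl.
move=> i n1i; have ni : (n <= i)%N by rewrite (leq_trans (leq_addr _ _) n1i).
apply: le_trans (ball _ ni) _; rewrite mulrDl lerD //.
  by have := bad_le (i - n1)%N; rewrite subnKC.
by apply: le_trans (seen_le _ n1i) _; rewrite ler_pM2l.
Qed.

End NecessaryRates.

(** * The interval of rates, and the rate at 0 and 1 *)

Section Spectrum.
Context (R : realType) (m : nat) (rho : R) (d p : 'I_m.+1 -> R).
Context (M : R -> R -> R) (T : seq R) (S : ifs_setting rho d p M T).

Local Notation y s := (Sword rho d s 0).
Local Notation p0 := (p ord0).

(** Were [t] not cheap, the masses inside [D] would decay at a rate above [t], and so would the
    balls around [x]: directly if [x] is interior to [D], through [one_sided_ball] if it is an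
    end. *)
Lemma cheap_rate_of_copy tau x t n D n' D' : 0 <= x <= 1 ->
  cell rho d n D -> D.1 <= x <= D.2 ->
  cell rho d n' D' -> in_tau rho d tau D' -> same_type rho d n D n' D' ->
  decay_rate rho M x t -> cheap_rate rho d M tau t.
Proof.
move=> x01 cD /andP[xD1 xD2] cD' tD' sim xt; apply: contrapT => nct.
have [e [n0 [e0 ov pq]]] := not_cheap_rate S nct.
have [c [C [C0 MP]]] := overpriced_copy S ov cD cD' tD' sim.
have D12 : D.1 < D.2 by case: cD.
have one_side right (w : R) : 0 < w -> endpt rho d n x ->
    (forall i, rho ^+ i <= w -> if right then D.1 <= x /\ x + rho ^+ i <= D.2
       else D.1 <= x - rho ^+ i /\ x <= D.2) -> False.
  move=> w0 xn inD; have [i0 i0P] := exp_small S w0.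
  have lt : t + e / 2 < t + e by lra.
  have [|c' [C' [i0' [C'0 ball]]]] := @one_sided_ball _ _ _ _ _ _ _ S x right n (t + e) (t + e / 2) c C (maxn n0 i0) xn C0 lt pq.
    move=> i; rewrite geq_max => /andP[n0i i0i].
    have := inD (c + i)%N (ltW (i0P _ (leq_trans i0i (leq_addl _ _)))).
    have := exp_gt0 S (c + i)%N; case: (right) => r0 [h1 h2]; apply: MP => //; lra.
  have := decay_rate_ge S x01 xt C'0 ball; lra.
have [xE1|xD1'] := eqVneq x D.1.
  apply: (one_side true (D.2 - D.1)); rewrite ?subr_gt0 // ?xE1; first by case: cD.
  by move=> i ?; split; lra.
have [xE2|xD2'] := eqVneq x D.2.
  apply: (one_side false (D.2 - D.1)); rewrite ?subr_gt0 // ?xE2; first by case: cD.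
  by move=> i ?; split; lra.
have lt1 : D.1 < x by rewrite lt_neqAle eq_sym xD1' xD1.
have lt2 : x < D.2 by rewrite lt_neqAle xD2' xD2.
have [i1 i1P] : exists i1, forall i, (i1 <= i)%N -> rho ^+ i < Num.min (x - D.1) (D.2 - x).
  by apply: (exp_small S); rewrite lt_min !subr_gt0 lt1.
(* The diameter of a ball is twice its radius; [c0] compensates. *)
have [c0 c0P] := @exp_small _ _ _ _ _ _ _ S (1 / 2) ltac:(lra).
suff : t + e <= t by lra.
apply: (@decay_rate_ge _ _ _ _ _ _ _ S x t (t + e) (c0 + c)%N C (maxn n0 i1) x01 xt C0) => i.
rewrite geq_max => /andP[n0i i1i].
have := i1P _ (leq_trans i1i (leq_addl (c0 + c) i)); rewrite lt_min => /andP[h1 h2].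
have r0 := exp_gt0 S (c + i); have := c0P _ (leqnn _) => hc.
have rE : rho ^+ (c0 + c + i) = rho ^+ c0 * rho ^+ (c + i) by rewrite -addnA exprD.
have := exp_gt0 S (c0 + c + i) => r1.
apply: MP => //; rewrite ?rE in h1 h2 r1 *; [lra | lra | lra | nra].
Qed.

Lemma rate_spectrum : exists A B, [/\ A <= B,
  forall t, A <= t <= B -> exists2 x, 0 <= x <= 1 & decay_rate rho M x t &
  forall x t, 0 <= x <= 1 -> essential_point rho d x -> decay_rate rho M x t -> A <= t <= B].
Proof.
have [tau [rig tau0 tau1]] := rigid_word S.
have [A [B [AB ABP]]] := rates_interval S tau.
exists A, B; split => // [t /ABP[ct dt]|x t x01 xe xt].
  by have [x [x01 xt]] := rate_attained S rig tau0 tau1 ct dt; exists x.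
have [n [D [n' [D' [cD xD cD' tD' sim]]]]] := essential_copy S rig xe.
apply/ABP; split; first exact: cheap_rate_of_copy x01 cD xD cD' tD' sim xt.
exact: (dear_rate_of_copy S cD xD cD' tD' sim xt).
Qed.

Lemma geometric_rate x : 0 <= x <= 1 -> (exists N, forall n, (N <= n)%N ->
    M (x - rho ^+ n.+1) (x + rho ^+ n.+1) = p0 * M (x - rho ^+ n) (x + rho ^+ n)) ->
  decay_rate rho M x (- ln p0).
Proof.
move=> x01 [N NP] e e0.
pose mu n := M (x - rho ^+ n) (x + rho ^+ n).
have muE k : mu (N + k)%N = p0 ^+ k * mu N.
  elim: k => [|k IH]; first by rewrite addn0 expr0 mul1r.
  by rewrite addnS /mu NP ?leq_addr // -/(mu _) IH exprS mulrA.
have [K KP] := natr_bound (e^-1 * `|ln p0 * N%:R - ln (mu N)|).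
exists (maxn N K) => n; rewrite geq_max => /andP[Nn Kn].
have muN : 0 < mu N by exact: (ball_mass_gt0 S).
rewrite -/(mu n) -(subnKC Nn) muE lnM ?posrE ?(p0X_gt0 S) // lnXn ?(p_gt0 S) //.
have -> : - (ln p0 *+ (n - N) + ln (mu N)) - - ln p0 * (N + (n - N))%:R = ln p0 * N%:R - ln (mu N).
  by rewrite natrD -mulr_natr; ring.
rewrite subnKC // -ler_pdivrMl // (le_trans KP) // ler_nat //.
Qed.

(** Small balls around 0 meet the cylinder of the first map only, so shrinking by [rho] multiplies
    the mass by exactly [p0]. *)
Lemma decay_rate_left : decay_rate rho M 0 (- ln p0).
Proof.
apply: geometric_rate; first by rewrite lexx ler01.
have [e e0 eP] := min_positive [seq d j | j <- enum 'I_m.+1].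
have [N NP] := exp_small S e0; exists N => n Nn.
have r0 := rho_gt0 S; have rn := NP n.+1 (leqW Nn).
have rn0 : rho != 0 by rewrite lt0r_neq0.
rewrite (mass_self_similar S) (bigD1 ord0) //= big1 ?addr0 => [|j j0].
  by congr (_ * M _ _); rewrite (d_first S) exprS; field.
rewrite (mass_null S) ?mulr0 // => z /andP[z0 z1] /andP[_].
have dj : 0 < d j by rewrite -(d_first S) (d_incr S) // lt0n; apply: contra j0 => /eqP j0; apply/eqP/val_inj.
have := eP (d j) (map_f _ (mem_enum _ j)) dj => ej.
rewrite mulrC ler_pdivlMr //; have := mulr_gt0 z0 r0; lra.
Qed.

Lemma decay_rate_right : decay_rate rho M 1 (- ln p0).
Proof.
apply: geometric_rate; first by rewrite lexx ler01.
have [e e0 eP] := min_positive [seq 1 - rho - d j | j <- enum 'I_m.+1].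
have [N NP] := exp_small S e0; exists N => n Nn.
have r0 := rho_gt0 S; have rn := NP n.+1 (leqW Nn).
have rn0 : rho != 0 by rewrite lt0r_neq0.
rewrite (mass_self_similar S) (bigD1 ord_max) //= big1 ?addr0 => [|j j0].
  by rewrite (p_last S); congr (_ * M _ _); rewrite (d_last S) exprS; field.
rewrite (mass_null S) ?mulr0 // => z /andP[z0 z1] /andP[+ _].
have dj : 0 < 1 - rho - d j.
  rewrite -(d_last S) subr_gt0 (d_incr S) //= ltn_neqAle -ltnS ltn_ord andbT.
  by apply: contra j0 => /eqP j0; apply/eqP/val_inj.
have := eP (1 - rho - d j) (map_f (fun j => 1 - rho - d j) (mem_enum _ j)) dj => ej.
rewrite mulrC ler_pdivrMr //; have : z * rho < 1 * rho by rewrite ltr_pM2r.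
lra.
Qed.

End Spectrum.

(** * From the measure to its interval masses *)

Section Mass.
Context (R : realType) (mu : probability (measurableTypeR R) R).

Definition itv_mass (a b : R) : R := fine (mu [set` `[a, b]]).

Lemma mass_fin (A : set (measurableTypeR R)) : measurable A -> mu A = (fine (mu A))%:E.
Proof. by move=> mA; rewrite fineK // fin_num_measure. Qed.

Lemma itv_mass_le a b a' b' : (forall z, a <= z <= b -> a' <= z <= b') ->
  itv_mass a b <= itv_mass a' b'.
Proof.
move=> sub; rewrite /itv_mass -lee_fin -!mass_fin; try exact: measurable_itv.
apply: le_measure; rewrite ?inE; try exact: measurable_itv.
by move=> z; rewrite /= !in_itv /=; apply: sub.
Qed.

Lemma itv_mass_cover a b a1 b1 a2 b2 a3 b3 :
  (forall z, a <= z <= b -> [\/ a1 <= z <= b1, a2 <= z <= b2 | a3 <= z <= b3]) ->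
  itv_mass a b <= itv_mass a1 b1 + itv_mass a2 b2 + itv_mass a3 b3.
Proof.
move=> sub; rewrite /itv_mass -lee_fin !EFinD -!mass_fin; try exact: measurable_itv.
have mi (i : interval R) : measurable ([set` i] : set (measurableTypeR R)) by exact: measurable_itv.
apply: le_trans (leeD2r _ (measureU2 mu (mi _) (mi _))).
apply: le_trans (measureU2 mu (measurableU _ _ (mi _) (mi _)) (mi _)).
apply: le_measure; rewrite ?inE; try exact: mi.
  by apply: measurableU => //; apply: measurableU.
move=> z; rewrite /= !in_itv /= => /sub[]; [by left; left | by left; right | by right].
Qed.

Lemma itv_mass_disjoint a b a' b' : itv_mass a b = 1 ->
  (forall z, a' <= z <= b' -> ~ (a <= z <= b)) -> itv_mass a' b' = 0.
Proof.
move=> ab1 dis; apply/eqP; rewrite eq_le fine_ge0 // andbT.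
have mi (i : interval R) : measurable ([set` i] : set (measurableTypeR R)) by exact: measurable_itv.
rewrite /itv_mass -lee_fin -mass_fin //.
have <- : mu (~` [set` `[a, b]]) = 0%:E.
  by rewrite probability_setC // (mass_fin (mi _)) -/(itv_mass a b) ab1 subee.
apply: le_measure; rewrite ?inE //; first exact: measurableC.
Qed.

Lemma itv_mass_le1 a b : itv_mass a b <= 1.
Proof.
by rewrite /itv_mass -lee_fin -mass_fin ?probability_le1 //; exact: measurable_itv.
Qed.

Lemma itv_mass_tight e : 0 < e -> exists k : R, forall r, k <= r -> 1 - e < itv_mass (- r) r.
Proof.
move=> e0.
have cv : (mu \o (fun n : nat => [set` `[- n%:R, n%:R]] : set (measurableTypeR R))) n @[n --> \oo] --> 1%E.
  have UE : \bigcup_n ([set` `[- n%:R : R, n%:R]] : set (measurableTypeR R)) = setT.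
    rewrite -subTset => x _; have [n nP] := natr_bound `|x|; exists n => //=.
    by rewrite in_itv /= -ler_norml.
  rewrite -(@probability_setT _ _ _ mu) -UE; apply: nondecreasing_cvg_mu.
  - by move=> n; exact: measurable_itv.
  - by rewrite UE; exact: measurableT.
  - move=> n k nk; rewrite subsetEset => x; rewrite /= !in_itv /= => /andP[h1 h2].
    have : n%:R <= k%:R :> R by rewrite ler_nat.
    by move=> ?; apply/andP; split; lra.
have /fine_cvgP[_ /cvgrPdist_lt /(_ _ e0) [n _ nP]] := cv.
have := nP n (leqnn n); rewrite /= ltr_norml => /andP[_ h].
exists n%:R => r nr; have : itv_mass (- n%:R) n%:R <= itv_mass (- r) r.
  by apply: itv_mass_le => z; lra.
by rewrite {1}/itv_mass; lra.
Qed.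

End Mass.

(** * Normalization, absence of atoms at 0 and 1, and covering, all drawn from the support *)

Section FromMeasure.
Context (R : realType) (m : nat) (rho : R) (d p : 'I_m.+1 -> R).
Context (mu : probability (measurableTypeR R) R).
Context (hm : (1 <= m)%N) (hrho : 0 < rho < 1)
  (hd : forall i j : 'I_m.+1, (i < j)%N -> d i < d j)
  (hp : forall j, 0 < p j) (hp1 : \sum_(j < m.+1) p j = 1)
  (hmu : self_similar rho d p mu)
  (hsupp : msupport mu = [set` `[0, 1]]).

Local Notation F := (itv_mass mu).
Local Notation alpha := (d ord0 / (1 - rho)).
Local Notation beta := (d ord_max / (1 - rho)).

Let r0 : 0 < rho. Proof. by case/andP: hrho. Qed.
Let r1 : rho < 1. Proof. by case/andP: hrho. Qed.
Let rn0 : rho != 0. Proof. by rewrite lt0r_neq0. Qed.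
Let r1n0 : 1 - rho != 0. Proof. by rewrite subr_eq0 eq_sym lt_eqF. Qed.

Lemma itv_mass_self_similar a b :
  F a b = \sum_j p j * F (rho^-1 * (a - d j)) (rho^-1 * (b - d j)).
Proof.
rewrite /itv_mass hmu; last exact: measurable_itv.
have pre j : Smap rho d j @^-1` [set` `[a, b]] =
    [set` `[rho^-1 * (a - d j), rho^-1 * (b - d j)]].
  apply/predeqP => x; rewrite /= !in_itv /= /Smap.
  by rewrite ler_pdivrMl // ler_pdivlMl // lerBlDr lerBrDr.
under eq_bigr => j _ do rewrite pre (mass_fin mu (measurable_itv _)) -EFinM.
by rewrite sumEFin.
Qed.

Lemma d_between j : d ord0 <= d j <= d ord_max.
Proof.
apply/andP; split.
  case: (posnP j) => [j0|j0]; last by rewrite ltW // hd.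
  by have -> : j = ord0 by apply/val_inj.
have := leq_ord j; rewrite leq_eqVlt => /orP[/eqP jm|jm]; last by rewrite ltW // hd.
by have -> : j = ord_max by apply/val_inj.
Qed.

Lemma alphaE : alpha = rho * alpha + d ord0. Proof. by field. Qed.
Lemma betaE : beta = rho * beta + d ord_max. Proof. by field. Qed.

Lemma scale_large (r k : R) : 0 < r -> exists n, k <= rho ^- n * r.
Proof.
move=> rr0; case: (leP k 0) => k0.
  by exists 0%N; rewrite expr0 invr1 mul1r; lra.
have r01 : 0 <= rho < 1 by rewrite r1 ltW.
have [n nP] := expr_small r01 (divr_gt0 rr0 k0).
exists n; have := nP n (leqnn n).
rewrite ltr_pdivlMr // => h; rewrite mulrC ler_pdivlMr ?exprn_gt0 // mulrC; exact: ltW.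
Qed.

(* The convex hull [[alpha, beta]] of the attractor carries [mu]: mass outside an
   [r]-neighbourhood is pushed to infinity by the inverse maps. *)
Lemma hull_mass r : 0 < r -> F (alpha - r) (beta + r) = 1.
Proof.
move=> rr0; apply/eqP; rewrite eq_le itv_mass_le1 /=.
have step (s : R) : 0 < s -> F (alpha - rho^-1 * s) (beta + rho^-1 * s) <= F (alpha - s) (beta + s).
  move=> s0; rewrite (itv_mass_self_similar (alpha - s)).
  have -> : F (alpha - rho^-1 * s) (beta + rho^-1 * s) =
      \sum_j p j * F (alpha - rho^-1 * s) (beta + rho^-1 * s) by rewrite -mulr_suml hp1 mul1r.
  apply: ler_sum => j _; rewrite ler_pM2l //; apply: itv_mass_le => z /andP[z1 z2].
  have /andP[dj1 dj2] := d_between j.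
  have e1 : rho * (alpha - rho^-1 * s) = alpha - d ord0 - s.
    by rewrite mulrBr mulVKf // {2}alphaE; ring.
  have e2 : rho * (beta + rho^-1 * s) = beta - d ord_max + s.
    by rewrite mulrDr mulVKf // {2}betaE; ring.
  rewrite ler_pdivrMl // ler_pdivlMl //.
  have := ler_wpM2l (ltW r0) z1; have := ler_wpM2l (ltW r0) z2; rewrite e1 e2 => h1 h2.
  by apply/andP; split; lra.
have steps n : F (alpha - rho ^- n * r) (beta + rho ^- n * r) <= F (alpha - r) (beta + r).
  elim: n => [|n IH]; first by rewrite expr0 invr1 mul1r.
  apply: le_trans IH; rewrite exprS invfM -mulrA; apply: step.
  by rewrite mulr_gt0 // invr_gt0 exprn_gt0.
rewrite leNgt; apply/negP => lt.
have [k kP] := @itv_mass_tight _ mu (1 - F (alpha - r) (beta + r)) ltac:(lra).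
have [n nP] := scale_large (k + `|alpha| + `|beta|) rr0.
have := kP (rho ^- n * r - `|alpha| - `|beta|) ltac:(lra).
have : F (- (rho ^- n * r - `|alpha| - `|beta|)) (rho ^- n * r - `|alpha| - `|beta|) <=
    F (alpha - rho ^- n * r) (beta + rho ^- n * r).
  apply: itv_mass_le => z /andP[z1 z2].
  have := ler_norm alpha; have := ler_norm (- alpha); have := ler_norm beta; have := ler_norm (- beta).
  by rewrite !normrN => *; apply/andP; split; lra.
by have := steps n; lra.
Qed.

(** Blowing up an interval around the fixed point of [S_j] costs a factor [p j] per step, while the
    blown-up intervals exhaust the line. So every neighbourhood of the fixed point has positive
    mass. *)
Lemma fixed_in_support j : 0 <= d j / (1 - rho) <= 1.
Proof.
set a := d j / (1 - rho); have aE : a = rho * a + d j by rewrite /a; field.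
suff : msupport mu a by rewrite hsupp /= in_itv.
move=> U oU Ua; have [e /= e0 eU] : exists2 e, 0 < e & ball a e `<=` U.
  by apply/nbhs_ballP; exact: open_nbhs_nbhs.
have pos s n : p j ^+ n * F (a - rho ^- n * s) (a + rho ^- n * s) <= F (a - s) (a + s).
  elim: n => [|n IH]; first by rewrite !expr0 invr1 !mul1r.
  apply: le_trans IH; rewrite exprSr -mulrA ler_pM2l ?exprn_gt0 //.
  rewrite [leRHS]itv_mass_self_similar (bigD1 j) //= exprS invfM.
  have -> : rho^-1 * (a - rho ^- n * s - d j) = a - rho^-1 * rho ^- n * s.
    by rewrite {1}aE; field; rewrite rn0 expf_neq0.
  have -> : rho^-1 * (a + rho ^- n * s - d j) = a + rho^-1 * rho ^- n * s.
    by rewrite {1}aE; field; rewrite rn0 expf_neq0.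
  rewrite lerDl; apply: sumr_ge0 => i _; apply: mulr_ge0; first exact: ltW.
  exact: fine_ge0.
have [k kP] := @itv_mass_tight _ mu (1 / 2) ltac:(lra).
have [n nP] := @scale_large (e / 2) (k + `|a|) ltac:(lra).
have big := kP (rho ^- n * (e / 2) - `|a|) ltac:(lra).
have : 0 < F (a - e / 2) (a + e / 2).
  apply: lt_le_trans (pos _ n); rewrite mulr_gt0 ?exprn_gt0 //.
  have : F (- (rho ^- n * (e / 2) - `|a|)) (rho ^- n * (e / 2) - `|a|) <=
    F (a - rho ^- n * (e / 2)) (a + rho ^- n * (e / 2)).
    apply: itv_mass_le => z /andP[z1 z2]; have := ler_norm a; have := ler_norm (- a).
    by rewrite normrN => *; apply/andP; split; lra.
  lra.
rewrite -lte_fin -mass_fin; last exact: measurable_itv.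
move=> h; apply: lt_le_trans h _; apply: le_measure; rewrite ?inE.
- exact: measurable_itv.
- exact: open_measurable.
- apply: subset_trans eU => z; rewrite /= in_itv /= => /andP[z1 z2].
  by rewrite /ball /= ltr_norml; apply/andP; split; lra.
Qed.

Lemma support_mass z e : 0 <= z <= 1 -> 0 < e -> 0 < F (z - e) (z + e).
Proof.
move=> z01 e0; have : msupport mu z by rewrite hsupp /= in_itv.
move=> /(_ _ (ball_open z e) (ballxx z e0)) h.
rewrite -lte_fin -mass_fin; last exact: measurable_itv.
apply: lt_le_trans h _; apply: le_measure; rewrite ?inE.
- exact: open_measurable (ball_open _ _).
- exact: measurable_itv.
- by move=> w; rewrite /ball /= in_itv /= ltr_norml => /andP[w1 w2]; apply/andP; split; lra.
Qed.

(** The fixed point [alpha] of the first map lies in the support, hence is at least 0. If it were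
    positive, [hull_mass] would leave no mass near 0, which is a point of the support. *)
Lemma first_eq0 : d ord0 = 0.
Proof.
have /andP[a0 _] := fixed_in_support ord0.
suff : alpha = 0 by move/eqP; rewrite mulf_eq0 invr_eq0 (negPf r1n0) orbF => /eqP.
apply/eqP; rewrite eq_le a0 andbT leNgt; apply/negP => a1.
have a2 : 0 < alpha / 2 by lra.
have a4 : 0 < alpha / 4 by lra.
have := @support_mass 0 (alpha / 4) _ a4; rewrite lexx ler01 => /(_ isT).
rewrite (itv_mass_disjoint (hull_mass a2)) ?ltxx // => z; lra.
Qed.

Lemma last_eq1 : d ord_max = 1 - rho.
Proof.
have /andP[_ b1] := fixed_in_support ord_max.
suff : beta = 1 by move/eqP; rewrite -subr_eq0 -{2}(divff r1n0) -mulrBl mulf_eq0 invr_eq0 (negPf r1n0) orbF subr_eq0 => /eqP.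
apply/eqP; rewrite eq_le b1 leNgt; apply/negP => b0.
have a2 : 0 < (1 - beta) / 2 by lra.
have a4 : 0 < (1 - beta) / 4 by lra.
have := @support_mass 1 ((1 - beta) / 4) _ a4; rewrite lexx ler01 => /(_ isT).
rewrite (itv_mass_disjoint (hull_mass a2)) ?ltxx // => z; lra.
Qed.

Lemma outer_mass r : 0 < r -> F (- r) (1 + r) = 1.
Proof.
by move=> /hull_mass; rewrite first_eq0 last_eq1 mul0r add0r divff.
Qed.

Lemma out_null a b : b < 0 \/ 1 < a -> F a b = 0.
Proof.
case=> h.
  have b2 : 0 < - b / 2 by lra.
  by apply: (itv_mass_disjoint (outer_mass b2)) => z; lra.
have a2 : 0 < (a - 1) / 2 by lra.
by apply: (itv_mass_disjoint (outer_mass a2)) => z; lra.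
Qed.

(** Only the first map sends mass to [[a, 0]], and it pulls this interval back to one of the same
    form; the mass is thus at most [p0 ^+ n] for all [n]. *)
Lemma left_null a : F a 0 = 0.
Proof.
have H n : F a 0 <= p ord0 ^+ n.
  elim: n a => [|n IH] a; first exact: itv_mass_le1.
  rewrite itv_mass_self_similar (bigD1 ord0) //= big1 ?addr0 => [|j j0].
    by rewrite first_eq0 subrr mulr0 exprS ler_pM2l.
  rewrite out_null ?mulr0 //; left; rewrite sub0r mulrN oppr_lt0 mulr_gt0 ?invr_gt0 //.
  by rewrite -first_eq0 hd // lt0n; apply: contra j0 => /eqP j0; apply/eqP/val_inj.
apply/eqP; rewrite eq_le fine_ge0 // andbT leNgt; apply/negP => h.
have p01 : 0 <= p ord0 < 1 by rewrite ltW //= (weight_lt1 _ hm hp hp1).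
by have [n nP] := expr_small p01 h; have := nP n (leqnn n); have := H n; lra.
Qed.

Lemma right_null b : F 1 b = 0.
Proof.
have H n : F 1 b <= p ord_max ^+ n.
  elim: n b => [|n IH] b; first exact: itv_mass_le1.
  rewrite itv_mass_self_similar (bigD1 ord_max) //= big1 ?addr0 => [|j j0].
    by rewrite last_eq1 opprB addrC subrK mulVf // exprS ler_pM2l.
  rewrite out_null ?mulr0 //; right; rewrite ltr_pdivlMl // mulr1.
  suff : d j < 1 - rho by lra.
  rewrite -last_eq1 hd //= ltn_neqAle -ltnS ltn_ord andbT.
  by apply: contra j0 => /eqP j0; apply/eqP/val_inj.
apply/eqP; rewrite eq_le fine_ge0 // andbT leNgt; apply/negP => h.
have p01 : 0 <= p ord_max < 1 by rewrite ltW //= (weight_lt1 _ hm hp hp1).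
by have [n nP] := expr_small p01 h; have := nP n (leqnn n); have := H n; lra.
Qed.

Lemma empty_mass : F 1 0 = 0.
Proof. exact: left_null. Qed.

Lemma inner_mass_mono a b a' b' : (forall z, 0 < z < 1 -> a <= z <= b -> a' <= z <= b') ->
  F a b <= F a' b'.
Proof.
move=> sub; suff : F a b <= F a 0 + F a' b' + F 1 b by rewrite left_null right_null add0r addr0.
apply: itv_mass_cover => z zab; move: (zab) => /andP[za zb].
case: (leP z 0) => z0; first by apply: Or31; rewrite za.
case: (leP 1 z) => z1; first by apply: Or33; rewrite zb.
by apply: Or32; apply: sub => //; rewrite z0.
Qed.

(** If [x] were missed, each first-level cylinder would end by [x] or start after [x + e] for a
    common [e]. The window in between would carry no mass, although it lies in the support. *)
Lemma half_open_cover x : 0 <= x < 1 -> exists j, d j <= x < d j + rho.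
Proof.
move=> /andP[x0 x1]; apply: contrapT => no.
have [e e0 eP] := min_positive ((1 - x) :: [seq d j - x | j <- enum 'I_m.+1]).
have e1 : e <= 1 - x by apply: eP; rewrite ?mem_head // subr_gt0.
have out j : d j + rho <= x \/ x + e <= d j.
  case: (leP (d j) x) => dx.
    by left; rewrite leNgt; apply/negP => h; apply: no; exists j; rewrite dx.
  right; have : e <= d j - x; last lra.
  apply: eP; last by rewrite subr_gt0.
  by rewrite inE (map_f (fun j => d j - x)) ?orbT // mem_enum.
have := @support_mass (x + e / 2) (e / 4) ltac:(lra) ltac:(lra).
rewrite itv_mass_self_similar big1 ?ltxx // => j _; rewrite out_null ?mulr0 //.
case: (out j) => h; [right|left].
  by rewrite ltr_pdivlMl // mulr1; lra.
by rewrite ltr_pdivrMl // mulr0; lra.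
Qed.

Context (hft : finite_type rho d) (hp0m : p ord0 = p ord_max) (hpmin : forall j, p ord0 <= p j).

Lemma offset_list : exists T : seq R, forall s s' : seq 'I_m.+1, size s = size s' ->
  `|Sword rho d s 0 - Sword rho d s' 0| <= rho ^+ size s ->
  rho ^- size s * (Sword rho d s 0 - Sword rho d s' 0) \in T.
Proof.
move: hft; rewrite /finite_type /= first_eq0 last_eq1 subr0 mulVf // => -[G [/finite_seqP[T ->] _ GP]].
(* [finite_type] concerns absolute values at levels [n >= 1]: the opposites restore the signs and 0
   serves the empty words. After normalization its constant [c] is 1, the bound on the offsets
   considered here. *)
exists (0 :: T ++ [seq - t | t <- T]) => s s' ss' near.
have [s0|s0] := posnP (size s).
  have s'0 : size s' = 0%N by rewrite -ss'.
  by rewrite (size0nil s0) (size0nil s'0) subrr mulr0 mem_head.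
have sz' : size s' == size s by rewrite ss'.
have := GP _ (in_tuple s) (Tuple sz') s0; rewrite /= => -[h|h].
  have rs : 0 < rho ^+ size s by rewrite exprn_gt0.
  by move: h; rewrite mulrC ltr_pdivlMr // mul1r; lra.
rewrite inE mem_cat; apply/orP; right; apply/orP.
have [ge|lt] := leP 0 (Sword rho d s 0 - Sword rho d s' 0).
  by left; move: h; rewrite ger0_norm.
right; move: h; rewrite ltr0_norm // mulrN => h; rewrite -[X in X \in _]opprK.
exact: (map_f (fun t => - t)).
Qed.

Lemma measure_ifs_setting : exists T, ifs_setting rho d p F T.
Proof.
have [T TP] := offset_list; exists T; split => //.
- exact: first_eq0.
- exact: last_eq1.
- exact: half_open_cover.
- apply/eqP; rewrite eq_le itv_mass_le1 /=.
  have : F (- 1) (1 + 1) <= F 0 1 by apply: inner_mass_mono => z /andP[z0 z1] _; rewrite !ltW.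
  by rewrite outer_mass // ltr01.
- exact: inner_mass_mono.
- move=> a c b; rewrite -[leRHS]addr0 -empty_mass; apply: itv_mass_cover => z /andP[za zb].
  by case: (leP z c) => zc; [apply: Or31; rewrite za | apply: Or32; rewrite zb ltW].
- exact: itv_mass_self_similar.
- exact: empty_mass.
Qed.

End FromMeasure.

(** * Local dimensions as decay rates along powers of [rho] *)

Section LocalDimensions.
Context (R : realType) (m : nat) (rho : R) (d p : 'I_m.+1 -> R).
Context (mu : probability (measurableTypeR R) R) (T : seq R).
Context (S : ifs_setting rho d p (itv_mass mu) T).

Local Notation F := (itv_mass mu).

Lemma ln_rho_lt0 : ln rho < 0.
Proof. by rewrite ln_lt0 // (rho_gt0 S) (rho_lt1 S). Qed.

Lemma dim_ratioE x r : dim_ratio mu x r = - ln (F (x - r) (x + r)) / - ln r.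
Proof. by rewrite invrN mulrNN. Qed.

Lemma ln_exp n : - ln (rho ^+ n) = - ln rho * n%:R.
Proof. by rewrite (lnXn _ (rho_gt0 S)) mulr_natr mulNrn. Qed.

Lemma decay_rate_of_cvg (x l : R) : 0 <= x <= 1 -> dim_ratio mu x r @[r --> 0^'+] --> l ->
  decay_rate rho F x (l * - ln rho).
Proof.
(* The radii start at [rho] rather than 1, as the quotient has denominator [ln 1 = 0] at radius
   1. *)
move=> x01 /cvg_at_rightP /(_ (fun n => rho ^+ n.+1)) H e e0.
have lr0 := ln_rho_lt0; have k0 : 0 < - ln rho by lra.
have /H/cvgrPdist_le : (forall n, 0 < rho ^+ n.+1) /\ rho ^+ n.+1 @[n --> \oo] --> (0 : R).
  split=> [n|]; first exact: (exp_gt0 S).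
  rewrite (cvg_shiftS (fun n => rho ^+ n)); apply: cvg_expr.
  by rewrite ger0_norm ?(rho_lt1 S) // ltW // (rho_gt0 S).
move=> /(_ (e / - ln rho) (divr_gt0 e0 k0)) [N _ NP].
exists N.+1 => -[//|n]; rewrite ltnS => /NP /=; rewrite dim_ratioE ln_exp => h.
have n0 : 0 < n.+1%:R :> R by rewrite ltr0n.
have kn0 : 0 < - ln rho * n.+1%:R by rewrite mulr_gt0.
set g := - ln (F _ _) in h *.
have -> : g - l * - ln rho * n.+1%:R = (g / (- ln rho * n.+1%:R) - l) * (- ln rho * n.+1%:R).
  by rewrite mulrBl divfK ?lt0r_neq0 // mulrA.
have -> : e * n.+1%:R = e / - ln rho * (- ln rho * n.+1%:R) by rewrite mulrA divfK ?lt0r_neq0.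
by rewrite normrM (gtr0_norm kn0) ler_pM2r // distrC.
Qed.

Lemma cvg_of_decay_rate (x t : R) : 0 <= x <= 1 -> decay_rate rho F x t ->
  dim_ratio mu x r @[r --> 0^'+] --> t / - ln rho.
Proof.
move=> x01 xt; apply/cvgrPdist_le => e e0.
have lr0 := ln_rho_lt0; have k0 : 0 < - ln rho by lra.
set k := - ln rho in k0 *.
(* A quarter is enough because [n.+1 <= 2 * n]; this leaves one half of [e * k] for the [|t|] lost
   by rounding the exponent. *)
have e4 : 0 < e * k / 4 by rewrite divr_gt0 ?mulr_gt0 //; lra.
have [N NP] := xt _ e4.
have [K KP] := natr_bound ((e * k / 2)^-1 * `|t|).
pose n0 := maxn N (maxn K 1).
have rn0 : 0 < rho ^+ n0 by exact: (exp_gt0 S).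
near=> r.
have r0 : 0 < r by near: r; exact: nbhs_right_gt.
have rn : r < rho ^+ n0 by near: r; exact: nbhs_right_lt.
have [i iP] := exp_small S r0.
have ex : exists i, rho ^+ i < r by exists i; exact: iP.
case: (ex_minnP ex) => -[|n]; first by rewrite expr0 => h; have := exp_le1 S n0; lra.
move=> nr nmin; have rle : r <= rho ^+ n.
  by rewrite leNgt; apply/negP => /nmin; rewrite ltnn.
have n0n : (n0 <= n)%N.
  rewrite leqNgt; apply/negP => h.
  have : rho ^+ n0 <= rho ^+ n.+1 by rewrite ler_wiXn2l ?(ltW (rho_gt0 S)) ?(ltW (rho_lt1 S)).
  lra.
move: (n0n); rewrite !geq_max => /and3P[Nn Kn n1].
rewrite dim_ratioE; set h := - ln (F _ _); set la := - ln r.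
have M0 j := ball_mass_gt0 S j x01.
have h_lo : - ln (F (x - rho ^+ n) (x + rho ^+ n)) <= h.
  have le : F (x - r) (x + r) <= F (x - rho ^+ n) (x + rho ^+ n).
    by apply: itv_mass_le => z; lra.
  rewrite lerN2 ler_ln ?posrE ?M0 //; apply: lt_le_trans (M0 n.+1) _.
  by apply: itv_mass_le => z; lra.
have h_hi : h <= - ln (F (x - rho ^+ n.+1) (x + rho ^+ n.+1)).
  have le : F (x - rho ^+ n.+1) (x + rho ^+ n.+1) <= F (x - r) (x + r).
    by apply: itv_mass_le => z; lra.
  by rewrite lerN2 ler_ln ?posrE ?M0 // (lt_le_trans (M0 n.+1) le).
have la_lo : k * n%:R <= la by rewrite /k -ln_exp lerN2 ler_ln ?posrE ?(exp_gt0 S).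
have la_hi : la <= k * n.+1%:R by rewrite /k -ln_exp lerN2 ler_ln ?posrE ?(exp_gt0 S) // ltW.
have nn1 : 1 <= n%:R :> R by rewrite ler1n.
have := NP n Nn; have := NP n.+1 (leqW Nn); rewrite !ler_norml => /andP[_ g_hi] /andP[g_lo _].
have t_n : `|t| <= e * k / 2 * n%:R.
  rewrite -ler_pdivrMl ?(le_trans KP) ?ler_nat //.
  by rewrite divr_gt0 ?mulr_gt0 //; lra.
have la0 : 0 < la by apply: lt_le_trans la_lo; rewrite mulr_gt0 //; lra.
(* The real exponent with [r = rho ^ q], which lies between [n] and [n.+1]. *)
pose q := la / k.
have laE : la = k * q by rewrite mulrC divfK // lt0r_neq0.
have q1 : n%:R <= q by rewrite -(ler_pM2l k0) -laE.
have q2 : q <= n.+1%:R by rewrite -(ler_pM2l k0) -laE.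
rewrite -natr1 in g_hi q2.
have t1 := ler_norm t; have := ler_norm (- t); rewrite normrN => t2.
have u1 : `|t| * (n%:R + 1 - q) <= `|t| by rewrite ler_piMr //; lra.
have u2 : `|t| * (q - n%:R) <= `|t| by rewrite ler_piMr //; lra.
have u3 := ler_wpM2r (_ : 0 <= n%:R + 1 - q) t1; rewrite subr_ge0 in u3; have {}u3 := u3 q2.
have u4 := ler_wpM2r (_ : 0 <= q - n%:R) t1; rewrite subr_ge0 in u4; have {}u4 := u4 q1.
have ek : 0 < e * k by rewrite mulr_gt0.
have ekn := ler_wpM2l (ltW ek) q1.
have ek1 := ler_wpM2l (ltW ek) nn1.
have key : `|t * q - h| <= e * (k * q).
  rewrite ler_norml mulrA; apply/andP; split; lra.
have -> : t / k - h / la = (t * q - h) / la.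
  by rewrite laE; field; rewrite !lt0r_neq0 //; lra.
by rewrite -ler_norml normrM normfV (gtr0_norm la0) ler_pdivrMr // laE.
Unshelve. all: by end_near. Qed.

End LocalDimensions.
Unset Implicit Arguments.
Set Strict Implicit.

Theorem corollary5p9 (R : realType) (m : nat) (rho : R)
    (d p : 'I_m.+1 -> R) (mu : probability (measurableTypeR R) R)
    (hm : (1 <= m)%N) (hrho : 0 < rho < 1)
    (hd : forall i j : 'I_m.+1, (i < j)%N -> d i < d j)
    (hp : forall j, 0 < p j) (hp1 : \sum_(j < m.+1) p j = 1)
    (hmu : self_similar rho d p mu)
    (hft : finite_type rho d)
    (hp0m : p ord0 = p ord_max) (hpmin : forall j, p ord0 <= p j)
    (hsupp : msupport mu = [set` `[0, 1]])
    (hess : [set x | essential_point rho d x] = [set` `]0, 1[]) :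
  [/\ locdim_exists mu 0, locdim_exists mu 1, locdim mu 0 = locdim mu 1 &
      exists a b : R, a <= b /\
        [set locdim mu x | x in [set x | x \in `[0, 1] /\ locdim_exists mu x]]
        = [set` `[a, b]] `|` [set locdim mu 0]].
Proof.
have [T S] := measure_ifs_setting hm hrho hd hp hp1 hmu hsupp hft hp0m hpmin.
have [A [B [AB att nec]]] := rate_spectrum S.
have k0 : 0 < - ln rho by rewrite oppr_gt0 (ln_rho_lt0 S).
have dim_of_rate x t : 0 <= x <= 1 -> decay_rate rho (itv_mass mu) x t ->
    locdim_exists mu x /\ locdim mu x = t / - ln rho.
  move=> x01 xt; have c := cvg_of_decay_rate S x01 xt; split.
    by apply/cvg_ex; exists (t / - ln rho).
  exact: (cvg_lim (@Rhausdorff R) c).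
have c00 : 0 <= (0 : R) <= 1 by rewrite lexx ler01.
have c11 : 0 <= (1 : R) <= 1 by rewrite lexx ler01.
have [e0 d0] := dim_of_rate 0 _ c00 (decay_rate_left S).
have [e1 d1] := dim_of_rate 1 _ c11 (decay_rate_right S).
split => //; first by rewrite d0 d1.
exists (A / - ln rho), (B / - ln rho); split; first by rewrite ler_pM2r ?invr_gt0.
apply/seteqP; split => z /=; rewrite in_itv /=.
- move=> [x [+ ex] <-]; rewrite in_itv /= => x01.
  have [->|x0] := eqVneq x 0; first by right.
  have [->|x1] := eqVneq x 1; first by right; rewrite d0 d1.
  left; have xess : essential_point rho d x.
    suff : [set x | essential_point rho d x] x by [].
    by rewrite hess /= in_itv /= !lt_neqAle eq_sym x0 x1.
  have := nec _ _ x01 xess (decay_rate_of_cvg S x01 ex).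
  by rewrite ler_pdivrMr // ler_pdivlMr.
- case=> [zAB|->]; last by exists 0 => //; split => //; rewrite in_itv.
  have [|x x01 xz] := att (z * - ln rho).
    by move: zAB; rewrite ler_pdivrMr // ler_pdivlMr.
  have [ex dx] := dim_of_rate _ _ x01 xz.
  by exists x; [split => //; rewrite in_itv | rewrite dx mulfK ?lt0r_neq0].
Qed.
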